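(* Let $H\in\mathcal N_2$ be a normal affine semigroup in $\mathbb N^2$ with extremal rays $\mathbf a_1=(x_1,y_1)$ and $\mathbf a_2=(x_2,y_2)$, labeled so that $\mathbf a_1$ is closer to the $x$-axis. Assume that $(1,1)$ belongs to $\omega_H$ (so $(1,1)$ is the bottom element of $H$). Then (a) $H$ is AG1 if and only if $x_1\equiv1 \bmod (x_1-y_1)$; (b) $H$ is AG2 if and only if $y_2\equiv1\bmod (y_2-x_2)$; (c) $(1,1)$ is an Ulrich element in $H$ if and only if $x_i\equiv1\bmod (x_i-y_i)$ for $i=1,2$.
   Context: $\mathbb N=\{0,1,2,\dots\}$. $\mathcal N_2$ is the class of normal affine semigroups $H\subseteq\mathbb N^2$ generating $\mathbb Z^2$ as a group: $H$ is a finitely generated submonoid of $\mathbb N^2$ with $H=C\cap\mathbb Z^2$, where $C\subseteq\mathbb R^2$ is the (two-dimensional) cone generated by $H$. The extremal rays of $H$ are the primitive lattice vectors $\mathbf a_1,\mathbf a_2\in H$ lying on the two extremal rays of $C$. They are labeled $\mathbf a_1=(x_1,y_1)$, $\mathbf a_2=(x_2,y_2)$ so that $x_1>0$ and either $x_2=0$ or $y_1/x_1<y_2/x_2$. Put $\omega_H=\mathbb Z^2\cap\operatorname{relint}C$. The bottom element $\mathbf b$ of $H$ is the unique element of $\omega_H$ that is minimal (least) in $\omega_H$ for the componentwise order on $\mathbb N^2$. For $i=1,2$, $H_i=\mathbb Z^2\cap\{r_1\mathbf a_i+r_2\mathbf b: r_1,r_2\in\mathbb R_{\ge0}\}$ and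 $H_i^*=\mathbb Z^2\cap\{r_1\mathbf a_i+r_2\mathbf b:0<r_1,r_2<1\}$. $H$ is called AG1 if $\mathbf p+\mathbf q\notin H_1^*$ for all $\mathbf p,\mathbf q\in H_1^*$, and AG2 if $\mathbf p+\mathbf q\notin H_2^*$ for all $\mathbf p,\mathbf q\in H_2^*$. Let $K$ be a field. $R=K[H]$ is the subalgebra of $K[x_1,x_2]$ (polynomial ring in two variables) spanned by the monomials $\mathbf x^{\mathbf h}$, $\mathbf h\in H$; its graded maximal ideal $\mathfrak m$ is generated by $\mathbf x^{\mathbf h}$, $0\ne\mathbf h\in H$. The canonical module $\omega_R$ is the ideal of $R$ spanned over $K$ by the monomials $\mathbf x^{\mathbf h}$, $\mathbf h\in\omega_H$. A graded Cohen–Macaulay $R$-module $E$ is Ulrich if its minimal number of generators equals its multiplicity $e(E)$ with respect to $\mathfrak m$; the zero module counts as Ulrich. An element $\mathbf c\in\omega_H$ is called an Ulrich element in $H$ if $\omega_R/\mathbf x^{\mathbf c}R$ is an Ulrich $R$-module. *)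

(* Defs.v *)
From HB Require Import structures.
From mathcomp Require Import all_boot all_order all_algebra ring_quotient.
From mathcomp Require Import mpoly.
From mathcomp Require Import boolp classical_sets reals.

Set Implicit Arguments.
Unset Strict Implicit.
Unset Printing Implicit Defensive.

Import Order.TTheory GRing.Theory Num.Theory.
Local Open Scope classical_set_scope.
Local Open Scope ring_scope.
Local Open Scope quotient_scope.

Section SubModule.
Variables (A : comNzRingType) (V : lmodType A) (W : submodClosed V).

Definition submod : Type := {v : V | v \in W}.
HB.instance Definition _ := SubChoice.on submod.
HB.instance Definition _ := [SubChoice_isSubLmodule of submod by <:].

Definition submod_val (x : submod) : V := \val x.

Lemma submod_val0 : submod_val 0 = 0. Proof. exact: raddf0. Qed.
Lemma submod_valD x y : submod_val (x + y) = submod_val x + submod_val y.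
Proof. exact: raddfD. Qed.
Lemma submod_valZ a x : submod_val (a *: x) = a *: submod_val x.
Proof. exact: linearZ. Qed.

End SubModule.

Section QuotientModule.
Variables (A : comNzRingType) (V : lmodType A) (N : submodClosed V).

Definition submod_pred : {pred V} := [pred v | v \in N].
Fact submod_pred_zmod_closed : zmod_closed submod_pred.
Proof. exact: GRing.submod_closedB (submodClosedP N). Qed.
HB.instance Definition _ :=
  GRing.isZmodClosed.Build V submod_pred submod_pred_zmod_closed.

(* MathComp's additive quotient, with the induced scalar action. *)
Definition quotmod : Type := Quotient.quot submod_pred.
HB.instance Definition _ := GRing.Zmodule.on quotmod.
HB.instance Definition _ := EqQuotient.on quotmod.

Definition quotmod_scale (a : A) (x : quotmod) : quotmod :=
  \pi_quotmod (a *: repr x).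

Lemma quotmod_eq (u v : V) : (\pi_quotmod u = \pi_quotmod v) <-> u - v \in N.
Proof.
have -> : (u - v \in N) = (u - v \in submod_pred) by [].
by rewrite Quotient.idealrBE; split=> [->|/eqP].
Qed.

Lemma quotmod_scale_pi (a : A) (v : V) :
  quotmod_scale a (\pi_quotmod v) = \pi_quotmod (a *: v).
Proof.
by apply/quotmod_eq; rewrite -scalerBr rpredZ //; apply/quotmod_eq; rewrite reprK.
Qed.

Lemma quotmod_addE (u v : V) :
  \pi_quotmod u + \pi_quotmod v = \pi_quotmod (u + v).
Proof. exact: esym (Quotient.pi_add submod_pred u v). Qed.

Lemma quotmodP (x : quotmod) : exists v : V, x = \pi_quotmod v.
Proof. by exists (repr x); rewrite reprK. Qed.

Fact quotmod_scaleA a b x :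
  quotmod_scale a (quotmod_scale b x) = quotmod_scale (a * b) x.
Proof. by have [v ->] := quotmodP x; rewrite !quotmod_scale_pi scalerA. Qed.
Fact quotmod_scale1 : left_id 1 quotmod_scale.
Proof. by move=> x; have [v ->] := quotmodP x; rewrite quotmod_scale_pi scale1r. Qed.
Fact quotmod_scaleDr : right_distributive quotmod_scale +%R.
Proof.
move=> a x y; have [u ->] := quotmodP x; have [v ->] := quotmodP y.
by rewrite quotmod_addE !quotmod_scale_pi quotmod_addE scalerDr.
Qed.
Fact quotmod_scaleDl x : {morph quotmod_scale^~ x : a b / a + b}.
Proof.
by move=> a b; have [v ->] := quotmodP x; rewrite !quotmod_scale_pi quotmod_addE scalerDl.
Qed.
HB.instance Definition _ := GRing.Zmodule_isLmodule.Build A quotmod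
  quotmod_scaleA quotmod_scale1 quotmod_scaleDr quotmod_scaleDl.

End QuotientModule.

(* d is the supremum of the lengths n of the strict chains
   c 0 < c 1 < ... < c n of sets satisfying P. *)
Definition chain_sup (T : Type) (P : set (set T)) (d : nat) : Prop :=
  let chain c n :=
    (forall i, (i <= n)%N -> P (c i)) /\ (forall i, (i < n)%N -> c i `<` c i.+1) in
  (exists c, chain c d) /\ (forall c n, chain c n -> (n <= d)%N).

Section Modules.
Variables (A : comNzRingType) (V : lmodType A).

Definition is_submodule (M : set V) : Prop :=
  M 0 /\ forall a u v, M u -> M v -> M (a *: u + v).

Definition span (S : set V) : set V :=
  [set v | forall M, is_submodule M -> S `<=` M -> M v].

Definition ideal_mul (I : set A) (M : set V) : set V :=
  span [set x | exists a v, I a /\ M v /\ x = a *: v].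

(* I^n V, as I (I (... (I V))). *)
Definition ideal_pow_mod (I : set A) (n : nat) : set V :=
  iter n (ideal_mul I) setT.

Definition ann : set A := [set a | forall v : V, a *: v = 0].

(* l is the length of V / W. *)
Definition has_colength (W : set V) (l : nat) : Prop :=
  chain_sup [set M | is_submodule M /\ W `<=` M] l.

Definition min_number_gens (n : nat) : Prop :=
  let gens (s : seq V) := span [set v | v \in s] = setT in
  (exists s, gens s /\ size s = n) /\ (forall s, gens s -> (n <= size s)%N).

End Modules.

Section UlrichModules.
Variable A : comNzRingType.

Definition ideal_gen (S : set A) : set A := @span A A^o S.

Definition is_prime_ideal (P : set A) : Prop :=
  [/\ @is_submodule A A^o P, ~ P 1 & forall a b, P (a * b) -> P a \/ P b].

Variable V : lmodType A.

Definition krull_dim (d : nat) : Prop :=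
  chain_sup [set P | is_prime_ideal P /\ ann V `<=` P] d.

Definition regular_seq (s : seq A) : Prop :=
  let sV k := ideal_mul [set a | a \in take k s] [set: V] in
  (forall k v, (k < size s)%N -> sV k (s`_k *: v) -> sV k v) /\
  sV (size s) <> setT.

Variable m : set A.

Definition depth (n : nat) : Prop :=
  let reg_in s := regular_seq s /\ (forall a, a \in s -> m a) in
  (exists s, reg_in s /\ size s = n) /\ (forall s, reg_in s -> (size s <= n)%N).

(* For a finitely generated graded module V <> 0 over a positively graded
   algebra with graded maximal ideal m, depth and dimension may be computed
   without localizing at m. *)
Definition cohen_macaulay : Prop := exists d, krull_dim d /\ depth d.

(* e = lim d! length(V / m^n V) / n^d, where d = dim V. *)
Definition multiplicity (e : rat) : Prop :=
  exists (d : nat) (l : nat -> nat),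
    [/\ krull_dim d, forall n, has_colength (ideal_pow_mod (V := V) m n) (l n)
      & forall eps : rat, 0 < eps -> exists N : nat, forall n : nat, (N < n)%N ->
          `|(d`! * l n)%:R / n%:R ^+ d - e| < eps].

Definition ulrich_module : Prop :=
  (forall v : V, v = 0) \/
  (cohen_macaulay /\ exists n : nat, min_number_gens V n /\ multiplicity n%:R).

End UlrichModules.

Notation Z2 := (int * int)%type.

Section Cones.
Variable R : realType.
Notation plane := (R^o * R^o)%type.

Definition real_pt (v : Z2) : plane := (v.1%:~R, v.2%:~R).

Definition cone (S : set plane) : set plane :=
  [set x | exists (n : nat) (t : 'I_n -> R) (s : 'I_n -> plane),
     (forall i, 0 <= t i /\ S (s i)) /\ x = \sum_i t i *: s i].

Definition affine_hull (S : set plane) : set plane :=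
  [set x | exists (n : nat) (t : 'I_n -> R) (s : 'I_n -> plane),
     [/\ forall i, S (s i), \sum_i t i = 1 & x = \sum_i t i *: s i]].

Definition relint (S : set plane) : set plane :=
  [set x | affine_hull S x /\ exists eps : R, 0 < eps /\
     forall y, affine_hull S y ->
       `|y.1 - x.1| < eps -> `|y.2 - x.2| < eps -> S y].

Definition ray (a : plane) : set plane :=
  [set x | exists r : R, 0 <= r /\ x = r *: a].

(* a spans a one-dimensional face of the cone C. *)
Definition on_extremal_ray (C : set plane) (a : plane) : Prop :=
  [/\ a <> 0, C a &
    forall u w, C u -> C w -> ray a (u + w) -> ray a u /\ ray a w].

Lemma coneD S x y : cone S x -> cone S y -> cone S (x + y).
Proof.
move=> [n [t [s [ts ->]]]] [k [t' [s' [ts' ->]]]].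
exists (n + k)%N.
exists (fun i => match split i with inl j => t j | inr j => t' j end).
exists (fun i => match split i with inl j => s j | inr j => s' j end).
split=> [i|]; first by case: (split i).
rewrite big_split_ord /=; congr (_ + _); apply: eq_bigr => i _.
  by rewrite (unsplitK (inl i)).
by rewrite (unsplitK (inr i)).
Qed.

Lemma affine_hull_move S x p q (a : R) :
  affine_hull S x -> S p -> S q -> affine_hull S (x + a *: (p - q)).
Proof.
move=> [n [t [s [Ss t1 ->]]]] Sp Sq.
exists (n.+2).
exists (fun i => match split (i : 'I_(2 + n)) with
  inl j => if j == ord0 then a else - a | inr j => t j end).
exists (fun i => match split (i : 'I_(2 + n)) with
  inl j => if j == ord0 then p else q | inr j => s j end).
split.
- by move=> i; case: (split (i : 'I_(2 + n))) => j //; case: ifP.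
- rewrite (@big_split_ord _ _ _ 2 n) /= !big_ord_recl big_ord0.
  rewrite !(unsplitK (inl _)) /= addr0 subrr add0r -t1.
  by apply: eq_bigr => i _; rewrite (unsplitK (inr _)).
- rewrite (@big_split_ord _ _ _ 2 n) /= !big_ord_recl big_ord0.
  rewrite !(unsplitK (inl _)) /= addr0 scaleNr -scalerBr addrC; congr (_ + _).
  by apply: eq_bigr => i _; rewrite (unsplitK (inr _)).
Qed.

Lemma cone0 S : cone S 0.
Proof.
exists 0%N, (fun=> 0), (fun=> 0); split; first by case.
by rewrite big_ord0.
Qed.

Lemma relint_coneD S x y :
  relint (cone S) x -> cone S y -> relint (cone S) (x + y).
Proof.
move=> [ax [eps [eps0 xeps]]] Cy; split.
  by rewrite -[y]scale1r -[y]subr0; apply: affine_hull_move => //; apply: cone0.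
exists eps; split=> // z az z1 z2; rewrite -[z](subrK y); apply: coneD => //.
apply: xeps.
- by rewrite -sub0r -[0 - y]scale1r; apply: affine_hull_move => //; apply: cone0.
- by rewrite /= -addrA -opprD addrC [y.1 + _]addrC [_ + z.1]addrC.
- by rewrite /= -addrA -opprD addrC [y.2 + _]addrC [_ + z.2]addrC.
Qed.

End Cones.

Definition is_submonoid (M : set Z2) : Prop :=
  M 0 /\ forall u v, M u -> M v -> M (u + v).

Definition is_subgroup (G : set Z2) : Prop :=
  G 0 /\ forall u v, G u -> G v -> G (u - v).

(* Submonoids of N^2, embedded in Z^2. *)
Record monoidN2 := MonoidN2 {
  monoid_set :> set Z2;
  monoid_submonoid : is_submonoid monoid_set;
  monoid_nneg : forall h, monoid_set h -> 0 <= h.1 /\ 0 <= h.2 }.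

Section Semigroups.
Variables (R : realType) (H : monoidN2).

Definition semigroup_cone : set (R^o * R^o) := cone (@real_pt R @` H).

Definition in_N2_class : Prop :=
  [/\ exists g : seq Z2,
        monoid_set H = [set h | forall M, is_submonoid M ->
                          (forall u, u \in g -> M u) -> M h],
      forall G, is_subgroup G -> H `<=` G -> G = setT &
      monoid_set H = [set v | semigroup_cone (real_pt R v)]].

Definition extremal_ray_of (a : Z2) : Prop :=
  [/\ monoid_set H a, coprimez a.1 a.2 & on_extremal_ray semigroup_cone (real_pt R a)].

(* a1 and a2 are the two extremal rays, a1 being the closer to the x-axis;
   the labeling condition forces a1 <> a2. *)
Definition labeled_extremal_rays (a1 a2 : Z2) : Prop :=
  [/\ extremal_ray_of a1, extremal_ray_of a2, 0 < a1.1 &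
      a2.1 = 0 \/ a1.2%:Q / a1.1%:Q < a2.2%:Q / a2.1%:Q].

Definition omega : set Z2 := [set v | relint semigroup_cone (real_pt R v)].

Definition is_bottom (b : Z2) : Prop :=
  omega b /\ forall h, omega h -> b.1 <= h.1 /\ b.2 <= h.2.

(* The lattice points of the open parallelogram spanned by a and b. *)
Definition Hstar (a b : Z2) : set Z2 :=
  [set v | exists r1 r2 : R, [/\ 0 < r1 < 1, 0 < r2 < 1 &
     real_pt R v = r1 *: real_pt R a + r2 *: real_pt R b]].

(* H is AGi if and only if AG a_i holds, for a_i the i-th extremal ray. *)
Definition AG (a : Z2) : Prop :=
  exists b, is_bottom b /\
    forall p q, Hstar a b p -> Hstar a b q -> ~ Hstar a b (p + q).

Lemma omegaD u v : omega u -> monoid_set H v -> omega (u + v).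
Proof.
move=> ou Hv; rewrite /omega /=.
have -> : real_pt R (u + v) = real_pt R u + real_pt R v.
  by rewrite /real_pt /= !intrD.
apply: relint_coneD => //; exists 1%N, (fun=> 1), (fun=> real_pt R v).
by split=> [_|]; [split=> //; exists v | rewrite big_ord1 scale1r].
Qed.

End Semigroups.

Definition mexp (m : 'X_{1..2}) : Z2 := ((m ord0)%:Z, (m ord_max)%:Z).

(* For h in N^2, the monomial x^h. *)
Definition xpow (K : fieldType) (h : Z2) : {mpoly K[2]} :=
  'X_ord0 ^+ `|h.1|%N * 'X_ord_max ^+ `|h.2|%N.

Definition monomial_span (K : fieldType) (S : set Z2) : {pred {mpoly K[2]}} :=
  [pred p | `[< forall m, m \in msupp p -> S (mexp m) >]].
Arguments monomial_span K S : clear implicits.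

Lemma monomial_spanP (K : fieldType) (S : set Z2) (p : {mpoly K[2]}) :
  reflect (forall m, m \in msupp p -> S (mexp m)) (p \in monomial_span K S).
Proof. exact: asboolP. Qed.

Lemma monomial_span0 (K : fieldType) S : 0 \in monomial_span K S.
Proof. by apply/monomial_spanP => m; rewrite msupp0. Qed.

Lemma monomial_spanB (K : fieldType) S (p q : {mpoly K[2]}) :
  p \in monomial_span K S -> q \in monomial_span K S ->
  p - q \in monomial_span K S.
Proof.
move=> /monomial_spanP Sp /monomial_spanP Sq; apply/monomial_spanP => m.
by move/msuppB_le; rewrite mem_cat => /orP[/Sp|/Sq].
Qed.

Lemma monomial_spanM (K : fieldType) S T U (p q : {mpoly K[2]}) :
  (forall u v, S u -> T v -> U (u + v)) ->
  p \in monomial_span K S -> q \in monomial_span K T ->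
  p * q \in monomial_span K U.
Proof.
move=> STU /monomial_spanP Sp /monomial_spanP Tq; apply/monomial_spanP => m.
move/msuppM_le/allpairsP => [[m1 m2] /= [/Sp S1 /Tq T2 ->]].
have -> : mexp (m1 + m2) = mexp m1 + mexp m2 by rewrite /mexp !mnmDE !PoszD.
exact: STU.
Qed.

Section SemigroupRing.
Variables (K : fieldType) (H : monoidN2).

Definition semigroup_pred : {pred {mpoly K[2]}} := monomial_span K H.

Fact semigroup_subring : subring_closed semigroup_pred.
Proof.
have [H0 HD] := monoid_submonoid H; split.
- by apply/monomial_spanP => m; rewrite msupp1 inE => /eqP ->; rewrite /mexp !mnm0E.
- by move=> p q; apply: monomial_spanB.
- by move=> p q; apply: monomial_spanM.
Qed.
HB.instance Definition _ :=
  GRing.isSubringClosed.Build _ semigroup_pred semigroup_subring.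

Definition semigroup_ring : Type := {p : {mpoly K[2]} | p \in semigroup_pred}.
HB.instance Definition _ := SubChoice.on semigroup_ring.
HB.instance Definition _ := [SubChoice_isSubComNzRing of semigroup_ring by <:].

Definition to_mpoly (f : semigroup_ring) : {mpoly K[2]} := \val f.

Lemma to_mpoly0 : to_mpoly 0 = 0. Proof. exact: raddf0. Qed.
Lemma to_mpolyB f g : to_mpoly (f - g) = to_mpoly f - to_mpoly g.
Proof. exact: raddfB. Qed.
Lemma to_mpolyD f g : to_mpoly (f + g) = to_mpoly f + to_mpoly g.
Proof. exact: raddfD. Qed.
Lemma to_mpolyM f g : to_mpoly (f * g) = to_mpoly f * to_mpoly g.
Proof. exact: (rmorphM (\val : semigroup_ring -> {mpoly K[2]})). Qed.

Definition graded_maximal_ideal : set semigroup_ring :=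
  ideal_gen [set f | exists h, [/\ monoid_set H h, h <> 0 & to_mpoly f = xpow K h]].

Variable R : realType.

Definition omega_pred : {pred semigroup_ring^o} :=
  [pred f | to_mpoly f \in monomial_span K (omega R H)].

Fact omega_submod : submod_closed omega_pred.
Proof.
split=> [|a u v]; first by rewrite unfold_in /= to_mpoly0; apply: monomial_span0.
rewrite !unfold_in /= => ou ov.
have -> : a *: u + v = (a : semigroup_ring) * u - (0 - v).
  by rewrite sub0r opprK.
rewrite !to_mpolyB to_mpolyM to_mpoly0 mulrC.
apply: monomial_spanB; last exact: monomial_spanB (monomial_span0 _ _) ov.
by apply: monomial_spanM ou (valP (a : semigroup_ring)); apply: omegaD.
Qed.
HB.instance Definition _ :=
  GRing.isSubmodClosed.Build _ _ omega_pred omega_submod.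

Definition canonical_module := submod omega_pred.

Definition omega_incl : canonical_module -> semigroup_ring := @submod_val _ _ _.

(* The multiples of x^c by elements of K[H] that lie in omega_R; for c in
   omega_H this is all of x^c R. *)
Definition xpow_multiples (c : Z2) : {pred canonical_module} :=
  [pred f | `[< exists r : semigroup_ring,
     to_mpoly (omega_incl f) = xpow K c * to_mpoly r >]].

Fact xpow_multiples_submod c : submod_closed (xpow_multiples c).
Proof.
split=> [|a u v /asboolP[r ur] /asboolP[s vs]]; apply/asboolP.
  by exists 0; rewrite /omega_incl submod_val0 !to_mpoly0 mulr0.
exists (a * r + s); rewrite /omega_incl submod_valD submod_valZ.
rewrite !to_mpolyD mulrDr -vs; congr (_ + _).
by rewrite !to_mpolyM ur mulrCA.
Qed.
HB.instance Definition _ c :=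
  GRing.isSubmodClosed.Build _ _ (xpow_multiples c) (xpow_multiples_submod c).

Definition omega_quotient (c : Z2) := quotmod (xpow_multiples c).

Definition ulrich_element (c : Z2) : Prop :=
  omega R H c /\ ulrich_module (omega_quotient c) graded_maximal_ideal.

End SemigroupRing.

(* Main.v *)
(* Write E = omega_R / x^b R with b = (1,1). The segment from 0 to b cuts the
   cone into two halves, and the exponents in omega_H outside b + H form two
   half-infinite strips, one along each extremal ray: v lies in the i-th one
   when 0 < |det(a_i, v)| < d_i = |x_i - y_i|. Hence E = E_1 + E_2, where E_i
   is free of rank d_i - 1 over K[x^(a_i)], a basis being given by the lattice
   points of the open parallelogram spanned by a_i and b. Every h <> 0 in H
   either moves a strip along its ray, or raises the bounded level
   |det(a_i, v)|, or kills it; so m^n E is trapped between two bounded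
   shifts of E along the rays and e(E) = (d_1 - 1) + (d_2 - 1). The same lattice
   points generate E, and they do so minimally exactly when none of them is
   the sum of another one and an element of H, that is, when AG1 and AG2 hold.
   On the parallelogram the level of the point with v.1 - v.2 = k is
   d_1 - (k y_1 mod d_1), and sum-freeness forces y_1 = 1 mod d_1. *)
Require Import Defs.
From mathcomp Require Import all_boot all_order all_algebra.
From mathcomp Require Import ring_quotient mpoly.
From mathcomp Require Import boolp classical_sets reals.
From mathcomp Require Import zify ring lra.
Set Implicit Arguments.
Unset Strict Implicit.
Unset Printing Implicit Defensive.
Import Order.TTheory GRing.Theory Num.Theory.
Local Open Scope ring_scope.

(** * The cone of a semigroup with given extremal rays *)

Section PlaneCones.
Variable R : realType.
Notation plane := (R^o * R^o)%type.

(** The Ulrich condition also asks for Cohen-Macaulayness, with dimension and depth read off from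
    chains of primes and regular sequences over all of K[H], not over a localization. Both are 1
    when E is nonzero. The parameter is T = x^(a_1) + x^(a_2): each ray vector moves its own strip
    and kills the other one, so T shifts the whole monomial basis by one step. A base point of
    highest level gives a socle element modulo T, and this bounds the depth. For the dimension,
    interior monomials act nilpotently on E, so a prime above the annihilator contains all monomials
    off one of the two rays; what remains is a polynomial ring in one variable. The length of E /
    m^n E is never computed exactly: two bounds that differ by a constant determine the limit.
    Combinatorics and algebra meet only in the properties listed in [strip_decomposition] and
    [monomial_module]. The second strip is the mirror image of the first under the reflection in the
    diagonal, which fixes b. *)

Definition rdet (u w : plane) : R := u.1 * w.2 - u.2 * w.1.

Lemma rdetDl u v w : rdet (u + v) w = rdet u w + rdet v w.
Proof. by rewrite /rdet /=; ring. Qed.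
Lemma rdetDr u v w : rdet w (u + v) = rdet w u + rdet w v.
Proof. by rewrite /rdet /=; ring. Qed.
Lemma rdetZl t u w : rdet (t *: u) w = t * rdet u w.
Proof.
by rewrite /rdet /= -[t *: u.1]/(t * u.1) -[t *: u.2]/(t * u.2); ring.
Qed.
Lemma rdetZr t u w : rdet w (t *: u) = t * rdet w u.
Proof.
by rewrite /rdet /= -[t *: u.1]/(t * u.1) -[t *: u.2]/(t * u.2); ring.
Qed.

Lemma cone_nonneg (S P : set plane) (x : plane) :
  P 0 -> (forall u w, P u -> P w -> P (u + w)) ->
  (forall (t : R) u, 0 <= t -> S u -> P (t *: u)) -> cone S x -> P x.
Proof.
move=> P0 PD PZ [n [t [s [ts ->]]]].
by apply: big_ind => // i _; have [? ?] := ts i; apply: PZ.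
Qed.

Lemma cone_scale (S : set plane) (t : R) (x : plane) :
  0 <= t -> cone S x -> cone S (t *: x).
Proof.
move=> t0; apply: (@cone_nonneg S (fun x => cone S (t *: x))).
- by rewrite scaler0; apply: cone0.
- by move=> u w; rewrite scalerDr; apply: coneD.
move=> r u r0 Su; exists 1%N, (fun=> t * r), (fun=> u); split=> [_|].
  by split=> //; apply: mulr_ge0.
by rewrite big_ord1 scalerA.
Qed.

(** A face absorbs the summands of its points: a positive combination that lands on the ray has its
    terms on the ray. *)
Lemma extremal_ray_det (S : set plane) (a u w : plane) (p q r : R) :
  on_extremal_ray (cone S) a -> cone S u -> cone S w -> 0 < p -> 0 < q ->
  0 < r -> r *: a = p *: u + q *: w -> rdet a u = 0.
Proof.
move=> [_ _ ext] Cu Cw p0 q0 r0 e.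
have [||//|[s [s0 es]] _] := ext (p *: u) (q *: w).
- exact: cone_scale (ltW p0) Cu.
- exact: cone_scale (ltW q0) Cw.
- by exists r; rewrite e; split=> //; apply: ltW.
have e1 : p * u.1 = s * a.1 by have := congr1 fst es.
have e2 : p * u.2 = s * a.2 by have := congr1 snd es.
apply: (mulfI (lt0r_neq0 p0)); rewrite mulr0 /rdet.
transitivity (a.1 * (p * u.2) - a.2 * (p * u.1)); first by ring.
by rewrite e1 e2; ring.
Qed.


End PlaneCones.

Definition cdet (u v : Z2) : int := u.1 * v.2 - u.2 * v.1.

Lemma cdetDr u v w : cdet u (v + w) = cdet u v + cdet u w.
Proof. by rewrite /cdet /=; ring. Qed.
Lemma cdetDl u v w : cdet (v + w) u = cdet v u + cdet w u.
Proof. by rewrite /cdet /=; ring. Qed.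

(** * Description of H and of its interior by two determinants *)

Section ExtremalRays.
Variables (R : realType) (H : monoidN2) (a1 a2 : Z2).
Hypothesis H_N2 : in_N2_class R H.
Hypothesis H_rays : labeled_extremal_rays R H a1 a2.

Local Notation pt := (real_pt R).
Local Notation C := (@semigroup_cone R H).

Lemma rdet_pt u v : rdet (pt u) (pt v) = (cdet u v)%:~R.
Proof. by rewrite /rdet /cdet /= rmorphB /= !rmorphM. Qed.

Lemma cone_pt v : monoid_set H v -> C (pt v).
Proof.
move=> Hv; exists 1%N, (fun=> 1), (fun=> pt v); split=> [_|].
  by split=> //; exists v.
by rewrite big_ord1 scale1r.
Qed.

Lemma extremal_cdet_gt0 : 0 < cdet a1 a2.
Proof.
have [[Ha1 _ _] [Ha2 _ [a20 _ _]] x1 lab] := H_rays.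
have [a11 a12] := monoid_nneg Ha1; have [a21 a22] := monoid_nneg Ha2.
rewrite /cdet; case: (ltrgtP (a2.1) 0) => [|x2|x2].
- by rewrite ltNge a21.
- case: lab => [e|]; first by move: x2; rewrite e ltxx.
  rewrite ltr_pdivrMr ?ltr0z // mulrAC ltr_pdivlMr ?ltr0z //.
  by rewrite -!intrM ltr_int subr_gt0 [_ * a1.1]mulrC.
- rewrite x2 mulr0 subr0 mulr_gt0 // lt_neqAle a22 andbT.
  apply/eqP => y2; apply: a20; rewrite /real_pt x2 -y2.
  by [].
Qed.

(** If [v] lay beyond [a1], then [a1] would be strictly between [v] and [a2], and extremality would
    put [v] on the ray of [a1]. The case of [a2] is symmetric. *)
Lemma monoid_cdet_ge0 v : monoid_set H v -> 0 <= cdet a1 v /\ 0 <= cdet v a2.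
Proof.
move=> Hv; have D0 := extremal_cdet_gt0.
have [[Ha1 _ e1] [Ha2 _ e2] x1 _] := H_rays.
have [a11 a12] := monoid_nneg Ha1; have [a21 a22] := monoid_nneg Ha2.
have [v1 v2] := monoid_nneg Hv.
split; rewrite leNgt; apply/negP => lt0.
- have p1 : 0 < cdet v a2.
    have v1_gt0 : 0 < v.1 by move: lt0; rewrite /cdet; nia.
    rewrite -(pmulr_rgt0 _ x1).
    (* First coordinate of the Cramer relation [cdet v a2] a1 = [cdet a1 a2] v - [cdet a1 v] a2,
       whose coefficients also serve as [r], [p], [q] below. *)
    have -> : a1.1 * cdet v a2 = v.1 * cdet a1 a2 + a2.1 * - cdet a1 v.
      by rewrite /cdet; ring.
    by rewrite ltr_wpDr ?mulr_gt0 // mulr_ge0 // oppr_ge0 ltW.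
  have p2 : 0 < - cdet a1 v by rewrite oppr_gt0.
  suff : rdet (pt a1) (pt v) = 0.
    by rewrite rdet_pt => /eqP; rewrite intr_eq0 lt_eqF.
  apply: (extremal_ray_det e1 (cone_pt Hv) (cone_pt Ha2)
    (p := (cdet a1 a2)%:~R) (q := (- cdet a1 v)%:~R) (r := (cdet v a2)%:~R));
    rewrite ?ltr0z //.
  apply: injective_projections; rewrite /= -[_ *: _]/(_ * _) -[RHS]/(_ * _ + _ * _).
    by rewrite -!intrM -intrD; congr _%:~R; rewrite /cdet; ring.
  by rewrite -!intrM -intrD; congr _%:~R; rewrite /cdet; ring.
- have p1 : 0 < cdet a1 v.
    have x2 : 0 < a2.1 by move: lt0; rewrite /cdet; nia.
    rewrite -(pmulr_rgt0 _ x2).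
    have -> : a2.1 * cdet a1 v = a1.1 * - cdet v a2 + v.1 * cdet a1 a2.
      by rewrite /cdet; ring.
    by rewrite ltr_wpDr ?mulr_gt0 // ?mulr_ge0 ?oppr_gt0 // ltW.
  have p2 : 0 < - cdet v a2 by rewrite oppr_gt0.
  suff : rdet (pt a2) (pt v) = 0.
    rewrite rdet_pt => /eqP; rewrite intr_eq0.
    by move: lt0; rewrite /cdet; lia.
  apply: (extremal_ray_det e2 (cone_pt Hv) (cone_pt Ha1)
    (p := (cdet a1 a2)%:~R) (q := (- cdet v a2)%:~R) (r := (cdet a1 v)%:~R));
    rewrite ?ltr0z //.
  apply: injective_projections; rewrite /= -[_ *: _]/(_ * _) -[RHS]/(_ * _ + _ * _).
    by rewrite -!intrM -intrD; congr _%:~R; rewrite /cdet; ring.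
  by rewrite -!intrM -intrD; congr _%:~R; rewrite /cdet; ring.
Qed.

Lemma cone_rdet_ge0 x : C x -> 0 <= rdet (pt a1) x /\ 0 <= rdet x (pt a2).
Proof.
apply: (@cone_nonneg _ _
  (fun x => 0 <= rdet (pt a1) x /\ 0 <= rdet x (pt a2))).
- by have := rdetZr 0 0 (pt a1); have := rdetZl 0 0 (pt a2);
    rewrite !scale0r !mul0r => -> ->.
- by move=> u w [u1 u2] [w1 w2]; rewrite rdetDl rdetDr; split; apply: addr_ge0.
- move=> t u t0 [v Hv <-]; have [v1 v2] := monoid_cdet_ge0 Hv.
  by rewrite rdetZl rdetZr !rdet_pt; split; apply: mulr_ge0; rewrite ?ler0z.
Qed.

Lemma rdet_ge0_cone x : 0 <= rdet (pt a1) x -> 0 <= rdet x (pt a2) -> C x.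
Proof.
move=> p1 p2; have D0 := extremal_cdet_gt0.
have [[Ha1 _ _] [Ha2 _ _] _ _] := H_rays.
have D : (0 : R) < (cdet a1 a2)%:~R by rewrite ltr0z.
have -> : x = (rdet x (pt a2) / (cdet a1 a2)%:~R) *: pt a1
            + (rdet (pt a1) x / (cdet a1 a2)%:~R) *: pt a2.
  rewrite -rdet_pt; move: D; rewrite -rdet_pt /rdet => /lt0r_neq0 D.
  by apply: injective_projections; rewrite /= -[_ *: _]/(_ * _) -[RHS]/(_ * _ + _ * _);
    field.
by apply: coneD; apply: cone_scale (cone_pt _) => //; rewrite divr_ge0 // ltW.
Qed.

Lemma monoidP v : monoid_set H v <-> 0 <= cdet a1 v /\ 0 <= cdet v a2.
Proof.
split=> [|[v1 v2]]; first exact: monoid_cdet_ge0.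
have [_ _ ->] := H_N2; apply: rdet_ge0_cone; rewrite rdet_pt ler0z //.
Qed.

Lemma omegaP v : omega R H v <-> 0 < cdet a1 v /\ 0 < cdet v a2.
Proof.
have D0 := extremal_cdet_gt0.
have [[Ha1 _ _] [Ha2 _ _] x1 _] := H_rays.
have [a11 a12] := monoid_nneg Ha1; have [a21 a22] := monoid_nneg Ha2.
split=> [[av [eps [eps0 near]]]|[v1 v2]].
- have shift (a : Z2) : monoid_set H a ->
      exists2 t : R, 0 < t & C (pt v - t *: pt a).
    move=> Ha; have [n1 n2] := monoid_nneg Ha.
    (* The sum exceeds both coordinates of [a]; the extra 1 keeps it positive, so that the step
       [eps / 2 / s] along [a] changes each coordinate by less than [eps]. *)
    pose s : R := (a.1 + a.2 + 1)%:~R.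
    have s0 : 0 < s by rewrite ltr0z; lia.
    exists (eps / 2 / s); first by rewrite !divr_gt0.
    have small (c : int) : 0 <= c <= a.1 + a.2 -> `|eps / 2 / s * c%:~R| < eps.
      move=> /andP[c0 cs]; rewrite ger0_norm; last first.
        by rewrite mulr_ge0 ?ler0z // ltW // !divr_gt0.
      apply: (@le_lt_trans _ _ (eps / 2)); last by lra.
      rewrite mulrAC ler_pdivrMr // ler_pM2l; last by lra.
      by rewrite ler_int; lia.
    apply: near.
    + rewrite -scaleNr -[pt a](subr0) .
      by apply: affine_hull_move => //; [exact: cone_pt | exact: cone0].
    + have -> : (pt v - (eps / 2 / s) *: pt a).1 - (pt v).1 =
        - (eps / 2 / s * a.1%:~R) by rewrite [LHS]addrAC subrr add0r.
      by rewrite normrN small //; lia.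
    + have -> : (pt v - (eps / 2 / s) *: pt a).2 - (pt v).2 =
        - (eps / 2 / s * a.2%:~R) by rewrite [LHS]addrAC subrr add0r.
      by rewrite normrN small //; lia.
  (* Moving from [v] a little against one ray vector stays in the cone, so the determinant with the
     other ray has room to decrease and is positive. *)
  split.
  + have [t t0 /cone_rdet_ge0[+ _]] := shift _ Ha2.
    have -> : rdet (pt a1) (pt v - t *: pt a2) =
       (cdet a1 v)%:~R - t * (cdet a1 a2)%:~R.
      by rewrite -scaleNr ?rdetDr ?rdetDl ?rdetZr ?rdetZl mulNr !rdet_pt.
    rewrite subr_ge0 => le; rewrite -(ltr0z R).
    by apply: lt_le_trans le; rewrite mulr_gt0 // ltr0z.
  + have [t t0 /cone_rdet_ge0[_ +]] := shift _ Ha1.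
    have -> : rdet (pt v - t *: pt a1) (pt a2) =
       (cdet v a2)%:~R - t * (cdet a1 a2)%:~R.
      by rewrite -scaleNr ?rdetDr ?rdetDl ?rdetZr ?rdetZl mulNr !rdet_pt.
    rewrite subr_ge0 => le; rewrite -(ltr0z R).
    by apply: lt_le_trans le; rewrite mulr_gt0 // ltr0z.
- have Hv : monoid_set H v by apply/monoidP; split; apply: ltW.
  split.
    exists 1%N, (fun=> 1), (fun=> pt v); split=> [_||]; first exact: cone_pt.
      by rewrite big_ord1.
    by rewrite big_ord1 scale1r.
  (* At a lattice point both determinants are at least 1, and a change of each coordinate by less
     than [1 / s] alters either of them by at most 1. *)
  pose s : R := (a1.1 + a1.2 + a2.1 + a2.2)%:~R.
  have s0 : 0 < s by rewrite ltr0z; lia.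
  exists (s^-1); split; first by rewrite invr_gt0.
  move=> y _ y1 y2; apply: rdet_ge0_cone.
  + have -> : rdet (pt a1) y = (cdet a1 v)%:~R + (a1.1%:~R * (y.2 - (pt v).2)
       - a1.2%:~R * (y.1 - (pt v).1)).
      by rewrite -rdet_pt /rdet /=; ring.
    have : 1 <= (cdet a1 v)%:~R :> R by rewrite ler1z; lia.
    have /ltr_normlP[z1 z2] := y1; have /ltr_normlP[z3 z4] := y2.
    have : s * s^-1 = 1 by rewrite mulfV // gt_eqF.
    have : 0 <= a1.1%:~R :> R by rewrite ler0z.
    have : 0 <= a1.2%:~R :> R by rewrite ler0z.
    have : 0 <= a2.1%:~R :> R by rewrite ler0z.
    have : 0 <= a2.2%:~R :> R by rewrite ler0z.
    rewrite {1}/s !intrD; move: z1 z2 z3 z4.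
    move: (y.2 - _) (y.1 - _) (s^-1) a1.1%:~R a1.2%:~R a2.1%:~R a2.2%:~R.
    move=> p q r A B A' B' *; nra.
  + have -> : rdet y (pt a2) = (cdet v a2)%:~R + (a2.2%:~R * (y.1 - (pt v).1)
       - a2.1%:~R * (y.2 - (pt v).2)).
      by rewrite -rdet_pt /rdet /=; ring.
    have : 1 <= (cdet v a2)%:~R :> R by rewrite ler1z; lia.
    have /ltr_normlP[z1 z2] := y1; have /ltr_normlP[z3 z4] := y2.
    have : s * s^-1 = 1 by rewrite mulfV // gt_eqF.
    have : 0 <= a1.1%:~R :> R by rewrite ler0z.
    have : 0 <= a1.2%:~R :> R by rewrite ler0z.
    have : 0 <= a2.1%:~R :> R by rewrite ler0z.
    have : 0 <= a2.2%:~R :> R by rewrite ler0z.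
    rewrite {1}/s !intrD; move: z1 z2 z3 z4.
    move: (y.2 - _) (y.1 - _) (s^-1) a1.1%:~R a1.2%:~R a2.1%:~R a2.2%:~R.
    move=> p q r A B A' B' *; nra.
Qed.

End ExtremalRays.

(** * A single strip *)

Lemma Z2_mulrnE (a : Z2) n : a *+ n = (n%:Z * a.1, n%:Z * a.2).
Proof.
case: a => p q /=; elim: n => [|n IH]; first by rewrite mulr0n !mul0r.
by rewrite mulrS IH -addn1 PoszD; congr (_, _) => /=; ring.
Qed.

Lemma cdet_aa a : cdet a a = 0.
Proof. by rewrite /cdet mulrC subrr. Qed.

Lemma cdetMn u v n : cdet u (v *+ n) = n%:Z * cdet u v.
Proof. by rewrite Z2_mulrnE /cdet /=; ring. Qed.

Lemma cdetMnl u v n : cdet (v *+ n) u = n%:Z * cdet v u.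
Proof. by rewrite Z2_mulrnE /cdet /=; ring. Qed.

Lemma cdet_eq0_multiple (a u : Z2) : coprimez a.1 a.2 ->
  0 <= a.1 -> 0 <= a.2 -> 0 <= u.1 -> 0 <= u.2 -> cdet a u = 0 ->
  exists n, u = a *+ n.
Proof.
case: a u => [p q] [r s] /= co p0 q0 r0 s0; rewrite /cdet /= => /subr0_eq e.
have [pe|pn] := eqVneq p 0.
  move: co; rewrite pe /coprimez gcd0z => /eqP q1.
  have {}q1 : q = 1 by lia.
  exists `|s|%N; rewrite Z2_mulrnE /fst /snd q1 mulr0 mulr1.
  by congr (_, _); move: e; rewrite pe q1; lia.
have /dvdzP[n rn] : (p %| r)%Z.
  by rewrite -(Gauss_dvdzr _ co) -e dvdz_mulr.
have n0 : 0 <= n by move: r0; rewrite rn pmulr_lge0 // lt_neqAle eq_sym pn.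
exists `|n|%N; rewrite Z2_mulrnE /fst /snd gez0_abs // rn; congr (_, _).
by apply: (mulfI pn); rewrite e rn; ring.
Qed.

Section Strip.
Variables x y : int.
Hypotheses (y_ge0 : 0 <= y) (yx : y < x) (co_xy : coprimez x y).
Local Notation a := (x, y).
Local Notation d := (x - y).

(** Since [x - y] is the determinant of [(x, y)] and [(1, 1)], these are the lattice points strictly
    between the ray and its translate by [(1, 1)], on the ray's side of the diagonal. *)
Definition in_strip (v : Z2) :=
  [/\ v.2 < v.1, 0 < cdet (x, y) v & cdet (x, y) v < x - y].

(* The point v of the strip with v.1 - v.2 = i + 1. *)
Definition strip_base (i : 'I_(`|x - y|%N.-1)) : Z2 :=
  let q := (y * i.+1%:Z %/ (x - y))%Z + 1 in (i.+1%:Z + q, q).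

Lemma coprimez_diff : coprimez d y.
Proof.
have -> : d = (- 1) * y + x by ring.
by rewrite /coprimez gcdzC gcdzMDl gcdzC.
Qed.

(** With k = v.1 - v.2 fixed, the determinant runs through one residue class modulo d as v.2 varies.
    So at most one v.2 puts it strictly between 0 and d, and none does when d divides k. *)
Lemma cdet_diff v : cdet a v = d * v.2 - y * (v.1 - v.2).
Proof. by rewrite /cdet /=; ring. Qed.

Lemma strip_base_diff i : (strip_base i).1 - (strip_base i).2 = i.+1%:Z.
Proof. by rewrite /= addrK. Qed.

Lemma cdet_strip_base i :
  cdet a (strip_base i) = d - (y * i.+1%:Z %% d)%Z.
Proof.
rewrite cdet_diff strip_base_diff [X in _ - X](divz_eq _ d) /strip_base /snd.
by ring.
Qed.

Lemma not_dvdz_lt (e c : int) : 0 < c -> c < e -> ~~ (e %| c)%Z.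
Proof.
move=> c0 ce; apply/negP => /dvdz_mod0P; rewrite modz_small; lia.
Qed.

Lemma strip_base_in i : in_strip (strip_base i).
Proof.
have ltid := ltn_ord i.
have d0 : 0 < d by lia.
have lt : 0 < i.+1%:Z < d by lia.
split; first by have := strip_base_diff i; lia.
- by rewrite cdet_strip_base; have := ltz_pmod (y * i.+1%:Z) d0; lia.
- rewrite cdet_strip_base.
  have : (y * i.+1%:Z %% d)%Z <> 0.
    move/dvdz_mod0P; rewrite Gauss_dvdzr ?coprimez_diff //.
    by apply/negP/not_dvdz_lt; lia.
  by have := modz_ge0 (y * i.+1%:Z) (lt0r_neq0 d0); lia.
Qed.

Lemma in_strip_eq v w : in_strip v -> in_strip w ->
  v.1 - v.2 = w.1 - w.2 -> v = w.
Proof.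
move=> [_ v1 v2] [_ w1 w2] e; suff e2 : v.2 = w.2.
  by apply: injective_projections => //; lia.
by move: v1 v2 w1 w2; rewrite !cdet_diff e; nia.
Qed.

Lemma in_stripD v n : in_strip v -> in_strip (v + a *+ n).
Proof.
move=> [v1 v2 v3]; split; rewrite ?cdetDr ?cdetMn ?cdet_aa ?mulr0 ?addr0 //.
by rewrite Z2_mulrnE /=; nia.
Qed.

(** The ray vector has coordinate difference d, so Euclidean division of v.1 - v.2 by d separates
    the base point from the number of steps. Remainder 0 would make d divide a determinant strictly
    between 0 and d. *)
Lemma in_stripP v : in_strip v <-> exists i n, v = strip_base i + a *+ n.
Proof.
split=> [st|[i [n ->]]]; last exact: in_stripD (strip_base_in i).
have [v1 v2 v3] := st; have d0 : 0 < d by lia.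
pose k := v.1 - v.2; pose r := (k %% d)%Z; pose n := (k %/ d)%Z.
have ek : k = n * d + r := divz_eq k d.
have r0 : 0 <= r := modz_ge0 k (lt0r_neq0 d0).
have rd : r < d := ltz_pmod k d0.
have n0 : 0 <= n by move: ek rd; rewrite /k; nia.
have rn0 : r <> 0.
  move=> e; have : (d %| cdet a v)%Z.
    rewrite cdet_diff -/k ek e addr0; apply/dvdzP; exists (v.2 - y * n).
    by ring.
  by apply/negP/not_dvdz_lt.
have ir : (`|r|.-1 < `|d|.-1)%N by lia.
exists (Ordinal ir), `|n|%N; apply: in_strip_eq => //.
  exact: in_stripD (strip_base_in _).
rewrite Z2_mulrnE -/k ek addrC /= .
have -> : (`|r|.-1.+1)%:Z = r by lia.
rewrite gez0_abs //; ring.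
Qed.

Lemma strip_base_inj i i' n n' :
  strip_base i + a *+ n = strip_base i' + a *+ n' -> i = i' /\ n = n'.
Proof.
move=> e; have ltid := ltn_ord i; have ltid' := ltn_ord i'.
have : i.+1%:Z + n%:Z * d = i'.+1%:Z + n'%:Z * d.
  rewrite -!strip_base_diff; move: e; rewrite !Z2_mulrnE.
  move: (strip_base i) (strip_base i') => [p q] [p' q'] [e1 e2].
  transitivity ((p + n%:Z * x) - (q + n%:Z * y)) => /=; first by ring.
  by rewrite e1 e2; ring.
move=> ek; have en : n = n' by nia.
by split=> //; apply: val_inj; move: ek; rewrite en /=; lia.
Qed.

(** On or above the diagonal x q - y p is at least d q, which is at least d unless the point is
    0. *)
Lemma diff_gt0_of_cdet_small (h : Z2) : 0 <= h.1 -> 0 <= h.2 -> h <> 0 ->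
  0 <= cdet a h -> cdet a h < d -> h.2 < h.1.
Proof.
case: h => [p q] /= p0 q0 h0; rewrite /cdet /= => h1 h2.
have [//|le] := ltP q p.
have [e|ne] := eqVneq p q; last by nia.
move: h2 h0; rewrite e => h2 h0; exfalso; apply: h0.
by have -> : q = 0 by nia.
Qed.

(** Both ends have determinant strictly between 0 and d, so [h] has determinant in [0, d). A nonzero
    such [h] increases the coordinate difference, hence n cannot drop; it is a multiple of the ray
    vector or raises the level. *)
Lemma strip_move i i' n n' (h : Z2) : 0 <= h.1 -> 0 <= h.2 -> 0 <= cdet a h ->
  strip_base i + a *+ n + h = strip_base i' + a *+ n' ->
  (n <= n')%N /\ ((i = i' /\ h = a *+ (n' - n)) \/
     cdet a (strip_base i) < cdet a (strip_base i')).
Proof.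
move=> h1 h2 ah e; have ltid := ltn_ord i; have ltid' := ltn_ord i'.
have [_ b1 b2] := strip_base_in i; have [_ b1' b2'] := strip_base_in i'.
have el : cdet a (strip_base i) + cdet a h = cdet a (strip_base i').
  by have := congr1 (cdet a) e; rewrite !cdetDr !cdetMn cdet_aa !mulr0 !addr0.
have [h0|hn0] := pselect (h = 0).
  move: e; rewrite h0 addr0 => /strip_base_inj[-> ->]; split=> //.
  by left; rewrite subnn mulr0n.
have hd : h.2 < h.1 by apply: diff_gt0_of_cdet_small => //; lia.
have ek : i.+1%:Z + n%:Z * d + (h.1 - h.2) = i'.+1%:Z + n'%:Z * d.
  rewrite -!strip_base_diff; move: e; rewrite !Z2_mulrnE.
  move: (strip_base i) (strip_base i') h {h1 h2 ah el hn0 hd b1 b2 b1' b2'}.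
  move=> [p q] [p' q'] [r s] [e1 e2] /=.
  transitivity ((p + n%:Z * x + r) - (q + n%:Z * y + s)) => /=; first by ring.
  by rewrite e1 e2; ring.
have nn' : (n <= n')%N by nia.
split=> //; have [ah0|] := eqVneq (cdet a h) 0; last by right; lia.
left; have [m hm] : exists m, h = a *+ m.
  by apply: cdet_eq0_multiple => //=; lia.
move: e; rewrite hm -addrA -mulrnDr => /strip_base_inj[-> <-]; split=> //.
by rewrite addKn.
Qed.

(** In the basis formed by the ray vector and [(1, 1)], a point has coefficients (v.1 - v.2) / d and
    det / d; the inequalities cut out the open parallelogram. *)
Definition strip_sumfree :=
  forall p q : Z2, 0 < p.1 - p.2 < d -> 0 < cdet a p < d ->
    0 < q.1 - q.2 < d -> 0 < cdet a q < d ->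
    ~ (0 < (p + q).1 - (p + q).2 < d /\ 0 < cdet a (p + q) < d).

(** Let g = y mod d. If g > 1, the points with differences 1 and floor(d / g) have their sum in the
    parallelogram. If g = 1, the point with difference k has level d - k, and a sum of two such
    points has level too large by d. *)
Lemma strip_sumfreeP : strip_sumfree <-> (x = 1 %[mod d])%Z.
Proof.
have d0 : 0 < d by lia.
split=> [sf|].
- pose g := (y %% d)%Z; pose t := (y %/ d)%Z.
  have ey : y = t * d + g := divz_eq y d.
  have g0 : 0 <= g := modz_ge0 y (lt0r_neq0 d0).
  have gd : g < d := ltz_pmod y d0.
  have co : coprimez d g.
    have : coprimez d (t * d + g) by rewrite -ey coprimez_diff.
    by rewrite /coprimez gcdzMDl.
  have mod1 : g = 1 -> (x = 1 %[mod d])%Z.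
    move=> g1; apply/eqP; rewrite eqz_mod_dvd; apply/dvdzP; exists (t + 1).
    by lia.
  have [gz|gn0] := eqVneq g 0.
    have -> : d = 1 by move: co; rewrite gz /coprimez gcdz0; lia.
    by rewrite !modz1.
  have [/mod1//|gn1] := eqVneq g 1.
  pose l := (d %/ g)%Z; pose s := (d %% g)%Z.
  have ed : d = l * g + s := divz_eq d g.
  have s0 : 0 <= s := modz_ge0 d gn0.
  have sg : s < g by apply: ltz_pmod; lia.
  have sn0 : s <> 0.
    move=> e; have : (g %| gcdz d g)%Z.
      by rewrite dvdz_gcd dvdzz andbT; apply/dvdzP; exists l; rewrite ed e addr0.
    by rewrite (eqP co) dvdz1; lia.
  have g_gt0 : 0 < g by rewrite lt_neqAle eq_sym gn0.
  have l_gt0 : 0 < l by rewrite -(pmulr_lgt0 _ g_gt0); lia.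
  have lg_gt0 : 0 < l * g by rewrite mulr_gt0.
  (* This gives l + 1 <= 2 l <= l g < d, so the sum of differences stays below d. *)
  have l2 : l * 2 <= l * g by rewrite ler_pM2l //; lia.
  (* The strip points with differences 1 and l, of levels d - g and d - l g. Their sum has level d -
     (g - s), because (l + 1) g - d = g - s. *)
  exfalso; apply: (sf (1 + (t + 1), t + 1) (l + (l * t + 1), l * t + 1));
    rewrite ?cdet_diff /=.
  + by lia.
  + have -> : d * (t + 1) - y * (1 + (t + 1) - (t + 1)) = d - g.
      by rewrite [in y * _]ey; ring.
    by lia.
  + by lia.
  + have -> : d * (l * t + 1) - y * (l + (l * t + 1) - (l * t + 1)) = d - l * g.
      by rewrite [in y * _]ey; ring.
    by lia.
  + split; first by lia.
    have -> : d * (t + 1 + (l * t + 1)) - y * (1 + (t + 1) + (l + (l * t + 1))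
       - (t + 1 + (l * t + 1))) = d - (l * g + g - d).
      by rewrite [in y * _]ey; ring.
    by lia.
- move/eqP; rewrite eqz_mod_dvd => /dvdzP[t et] p q.
  rewrite !cdet_diff => p1 p2 q1 q2 [r1 r2].
  have ey : y = (t - 1) * d + 1 by lia.
  (* In the parallelogram the factor of d must be 1, as shown by [eq1]. The factors add up, so the
     sum would have factor 2. *)
  have lev (v : Z2) : d * v.2 - y * (v.1 - v.2) =
      d * (v.2 - (t - 1) * (v.1 - v.2)) - (v.1 - v.2).
    by rewrite [in y * _]ey; ring.
  move: p2 q2 r2; rewrite !lev /=.
  set A := _ - (t - 1) * (p.1 - p.2); set B := _ - (t - 1) * (q.1 - q.2).
  have -> : p.2 + q.2 - (t - 1) * (p.1 + q.1 - (p.2 + q.2)) = A + B.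
    by rewrite /A /B; ring.
  move=> p2 q2 r2.
  have eq1 (C k : int) : 0 < k < d -> 0 < d * C - k < d -> C = 1.
    move=> k0 Ck; have : 0 < C by rewrite -(pmulr_rgt0 _ d0); lia.
    have : C < 2 by rewrite -(ltr_pM2l d0); lia.
    by lia.
  by move: r1 r2; rewrite (eq1 _ _ p1 p2) (eq1 _ _ q1 q2) /=; lia.
Qed.

End Strip.

(** * The cells outside b + H *)

(** Reflection in the diagonal: it fixes b and reverses determinants, so the strip along [(x2, y2)]
    becomes an [in_strip] for [(y2, x2)]. *)
Definition swap (v : Z2) : Z2 := (v.2, v.1).

Lemma swapD u v : swap (u + v) = swap u + swap v. Proof. by []. Qed.
Lemma swapMn u n : swap (u *+ n) = swap u *+ n.
Proof. by rewrite !Z2_mulrnE. Qed.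
Lemma swapK : involutive swap. Proof. by case. Qed.
Lemma cdet_swap u v : cdet (swap u) (swap v) = cdet v u.
Proof. by rewrite /cdet /=; ring. Qed.

(* The exponents of the monomials lying in omega_R but not in x^b R. *)
Definition cell (H : monoidN2) (b a1 a2 v : Z2) :=
  [/\ 0 < cdet a1 v, 0 < cdet v a2 & ~ monoid_set H (v - b)].

(* The monomials x^(pt j n) form a basis of omega_R / x^b R; the summand
   spanned by a fixed j is free over K[x^(dir j)], and lev j is the distance
   to the extremal ray. *)
Record strip_decomposition (H : monoidN2) (b a1 a2 : Z2) (J : finType)
  (pt : J -> nat -> Z2) (dir : J -> Z2) (lev : J -> nat) : Prop := {
  ptE : forall j n, pt j n = pt j 0%N + dir j *+ n;
  pt_inj : forall j n j' n', pt j n = pt j' n' -> j = j' /\ n = n';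
  cellE : forall v, cell H b a1 a2 v <-> exists j n, v = pt j n;
  pt_move : forall j n j' n' h, monoid_set H h -> pt j n + h = pt j' n' ->
    (n <= n')%N /\
    (j = j' /\ h = dir j *+ (n' - n) \/ (lev j < lev j')%N);
  dirE : forall j, dir j = a1 \/ dir j = a2;
  dir_other : forall j n a, a = a1 \/ a = a2 -> a <> dir j ->
    ~ cell H b a1 a2 (pt j n + a);
  extremal_split : forall a u v n, a = a1 \/ a = a2 -> monoid_set H u ->
    monoid_set H v -> u + v = a *+ n -> exists m, u = a *+ m;
  interior_multiple : forall u v, monoid_set H u -> monoid_set H v ->
    (forall m, u <> a1 *+ m) -> (forall m, v <> a2 *+ m) ->
    exists n, monoid_set H ((u + v) *+ n - b);
  cell_monoid : forall v, cell H b a1 a2 v -> monoid_set H v;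
  ray_monoid : monoid_set H a1 /\ monoid_set H a2;
  ray_neq0 : a1 <> 0 /\ a2 <> 0;
  ray_neq : a1 <> a2 }.

Section Cells.
Variables (H : monoidN2) (x1 y1 x2 y2 : int).
Local Notation a1 := (x1, y1).
Local Notation a2 := (x2, y2).
Local Notation b := ((1, 1) : Z2).
Hypotheses (y1_ge0 : 0 <= y1) (x2_ge0 : 0 <= x2).
Hypotheses (yx1 : y1 < x1) (xy2 : x2 < y2).
Hypotheses (co1 : coprimez x1 y1) (co2 : coprimez y2 x2).
Hypothesis HP : forall v, monoid_set H v <-> 0 <= cdet a1 v /\ 0 <= cdet v a2.

Local Notation cell := (cell H b a1 a2).
Local Notation strip1 := (in_strip x1 y1).
Local Notation strip2 := (in_strip y2 x2).
Local Notation base1 := (@strip_base x1 y1).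
Local Notation base2 := (@strip_base y2 x2).

(** This keeps the strips disjoint: a point of the second strip has determinant with [a2] below y2 -
    x2. *)
Lemma strip1_far v : strip1 v -> y2 - x2 <= cdet v a2.
Proof.
move=> [v1 v2 v3]; have : 0 < v.2.
  by move: v2; rewrite cdet_diff; nia.
rewrite (_ : cdet v a2 = (y2 - x2) * v.1 + x2 * (v.1 - v.2)); last first.
  by rewrite /cdet /=; ring.
by nia.
Qed.

Lemma strip2_far v : strip2 (swap v) -> x1 - y1 <= cdet a1 v.
Proof.
move=> [/= v1 v2 v3]; have : 0 < v.1.
  by move: v2; rewrite cdet_diff /=; nia.
rewrite (_ : cdet a1 v = (x1 - y1) * v.2 + y1 * (v.2 - v.1)); last first.
  by rewrite /cdet /=; ring.
by nia.
Qed.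

Lemma strip2_cdet v : cdet (y2, x2) (swap v) = cdet v a2.
Proof. by rewrite -cdet_swap swapK. Qed.

(** Subtracting b lowers the two determinants by d_1 and d_2. The result leaves H exactly when one
    of them becomes negative, that is, when [v] was close to a ray. *)
Lemma cellP v : cell v <-> strip1 v \/ strip2 (swap v).
Proof.
have e1 : cdet a1 (v - b) = cdet a1 v - (x1 - y1) by rewrite /cdet /=; ring.
have e2 : cdet (v - b) a2 = cdet v a2 - (y2 - x2) by rewrite /cdet /=; ring.
split=> [[v1 v2]|].
- have Hv : monoid_set H v by apply/HP; lia.
  have [p0 q0] := monoid_nneg Hv.
  have vn0 : v <> 0 by move=> e; move: v1; rewrite e /cdet /=; lia.
  move=> nH; have [lt|ge] := ltP (cdet a1 v) (x1 - y1).
    by left; split=> //; apply: (@diff_gt0_of_cdet_small x1 y1) => //; lia.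
  have lt : cdet v a2 < y2 - x2.
    by rewrite ltNge; apply/negP => ge'; apply: nH; apply/HP; lia.
  right; split; rewrite ?strip2_cdet //.
  apply: (@diff_gt0_of_cdet_small y2 x2); rewrite ?strip2_cdet //; last by lia.
  by move=> e; apply: vn0; rewrite -[v]swapK e.
- case=> st; split.
  + by case: st.
  + by have := strip1_far st; lia.
  + by case: st => _ _ lt /HP[]; rewrite e1; lia.
  + by have := strip2_far st; lia.
  + by rewrite -strip2_cdet; case: st.
  + by case: st; rewrite strip2_cdet => _ _ lt /HP[_]; rewrite e2; lia.
Qed.

Local Notation J := ('I_(`|x1 - y1|%N.-1) + 'I_(`|y2 - x2|%N.-1))%type.

Definition cell_dir (j : J) : Z2 := if j is inl _ then a1 else a2.

Definition cell_pt (j : J) (n : nat) : Z2 :=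
  match j with
  | inl i => base1 i + a1 *+ n
  | inr i => swap (base2 i) + a2 *+ n
  end.

Definition cell_lev (j : J) : nat :=
  match j with
  | inl i => `|cdet a1 (base1 i)|%N
  | inr i => `|cdet (y2, x2) (base2 i)|%N
  end.

Lemma swap_cell_pt i n :
  swap (cell_pt (inr i) n) = base2 i + (y2, x2) *+ n.
Proof. by rewrite /= swapD swapK swapMn. Qed.

Lemma strip_cell_pt1 i n : strip1 (cell_pt (inl i) n).
Proof. exact: in_stripD (strip_base_in _ _ _ _). Qed.

Lemma strip_cell_pt2 i n : strip2 (swap (cell_pt (inr i) n)).
Proof. by rewrite swap_cell_pt; exact: in_stripD (strip_base_in _ _ _ _). Qed.

(** Adding an element of H lowers neither determinant, and a point of one strip is already too far
    from the other ray; so no move changes strips. *)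
Lemma cell_pt_move j n j' n' h : monoid_set H h ->
  cell_pt j n + h = cell_pt j' n' ->
  [/\ cell_dir j = cell_dir j', (n <= n')%N &
    j = j' /\ h = cell_dir j *+ (n' - n) \/ (cell_lev j < cell_lev j')%N].
Proof.
move=> Hh; have [p0 q0] := monoid_nneg Hh; have /HP[h1 h2] := Hh.
case: j j' => i [] i' e.
- have [nn' [[-> eh]|lt]] := strip_move y1_ge0 yx1 co1 p0 q0 h1 e.
    by split=> //; left.
  split=> //; right => /=.
  have [_ + _] := strip_base_in y1_ge0 yx1 co1 i.
  have [_ + _] := strip_base_in y1_ge0 yx1 co1 i'.
  by lia.
- have [_ _] := strip_cell_pt2 i' n'; rewrite strip2_cdet -e cdetDl.
  by have := strip1_far (strip_cell_pt1 i n); lia.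
- have [_ _] := strip_cell_pt1 i' n'; rewrite -e cdetDr.
  by have := strip2_far (strip_cell_pt2 i n); lia.
- have h2' : 0 <= cdet (y2, x2) (swap h) by rewrite strip2_cdet.
  have e' : base2 i + (y2, x2) *+ n + swap h = base2 i' + (y2, x2) *+ n'.
    by rewrite -!swap_cell_pt -swapD e.
  have [nn' [[-> eh]|lt]] := @strip_move y2 x2 x2_ge0 xy2 co2 i i' n n' (swap h) q0 p0 h2' e'.
    by split=> //; left; split=> //; rewrite -[h]swapK eh swapMn.
  split=> //; right => /=.
  have [_ + _] := strip_base_in x2_ge0 xy2 co2 i.
  have [_ + _] := strip_base_in x2_ge0 xy2 co2 i'.
  by lia.
Qed.

Lemma cell_strips :
  strip_decomposition H b a1 a2 cell_pt cell_dir cell_lev.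
Proof.
split.
- by case=> i n /=; rewrite mulr0n addr0.
- move=> j n j' n' e.
  have H0 := (monoid_submonoid H).1.
  have [d1 nn' _] := cell_pt_move H0 (etrans (addr0 _) e).
  have [_ n'n _] := cell_pt_move H0 (etrans (addr0 _) (esym e)).
  have en : n = n' by apply/eqP; rewrite eqn_leq nn'.
  split=> //; move: e d1; rewrite en; case: j j' => i [] i' //=.
  + by move=> /(strip_base_inj y1_ge0 yx1 co1)[->].
  + by move=> _ []; lia.
  + by move=> _ []; lia.
  + move=> /(congr1 swap); rewrite !swapD !swapK swapMn.
    by move=> /(strip_base_inj x2_ge0 xy2 co2)[->].
- move=> v; split=> [/cellP[/(in_stripP y1_ge0 yx1 co1)[i [n ->]]|]|].
  + by exists (inl i), n.
  + move=> /(in_stripP x2_ge0 xy2 co2)[i [n e]].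
    by exists (inr i), n; rewrite -[v]swapK e swapD swapMn.
  + case=> -[] i [n ->]; apply/cellP.
      by left; apply: strip_cell_pt1.
    by right; apply: strip_cell_pt2.
- by move=> j n j' n' h Hh /(cell_pt_move Hh)[].
- by case=> i; [left | right].
- have Ha1 : monoid_set H a1 by apply/HP; rewrite /cdet /=; nia.
  have Ha2 : monoid_set H a2 by apply/HP; rewrite /cdet /=; nia.
  (* Adding the other ray vector keeps the distance to the other ray, which is too large for the
     other strip. Remaining in the same strip would put the added vector on the wrong side of the
     diagonal. *)
  case=> i n a ea ne /cellP.
  + have -> : a = a2 by case: ea.
    case=> [[_ _]|[_ _]].
      rewrite cdetDr; have [_ c0 _] := strip_cell_pt1 i n => lt.
      suff : a2.2 < a2.1 by rewrite /=; lia.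
      apply: (@diff_gt0_of_cdet_small x1 y1) => //=; try lia.
      by case; lia.
      by have /HP[] := Ha2.
      by apply: le_lt_trans lt; rewrite lerDr ltW.
    rewrite strip2_cdet cdetDl cdet_aa addr0; apply/negP; rewrite -leNgt.
    exact: strip1_far (strip_cell_pt1 i n).
  + have -> : a = a1 by case: ea.
    case=> [[_ _]|[_ _]].
      rewrite cdetDr cdet_aa addr0; apply/negP; rewrite -leNgt.
      exact: strip2_far (strip_cell_pt2 i n).
    rewrite strip2_cdet cdetDl; have [_ + _] := strip_cell_pt2 i n.
    rewrite strip2_cdet => c0 lt.
    suff : y1 > x1 by rewrite /=; lia.
    apply: (@diff_gt0_of_cdet_small y2 x2 x2_ge0 xy2 co2 (y1, x1)) => //=; try lia.
    by case; lia.
    by rewrite -/(swap a1) strip2_cdet; have /HP[] := Ha1.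
    by rewrite -/(swap a1) strip2_cdet; apply: le_lt_trans lt; rewrite lerDr ltW.
- move=> a u v n ea Hu Hv e.
  have [/HP[u1 u2] /HP[v1 v2]] := (Hu, Hv).
  have [p0 q0] := monoid_nneg Hu.
  case: ea e => -> e.
    apply: cdet_eq0_multiple => //=; first by lia.
    by have := congr1 (cdet a1) e; rewrite cdetDr cdetMn cdet_aa mulr0; lia.
  apply: cdet_eq0_multiple => //=; first by rewrite /coprimez gcdzC.
    by lia.
  have := congr1 (fun u => cdet u a2) e; rewrite cdetDl cdetMnl cdet_aa mulr0.
  by move: u2 v2; rewrite /cdet /=; lia.
- move=> u v Hu Hv nu nv.
  have [/HP[u1 u2] /HP[v1 v2]] := (Hu, Hv).
  have [p0 q0] := monoid_nneg Hu; have [r0 s0] := monoid_nneg Hv.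
  have u3 : 0 < cdet a1 u.
    rewrite lt_neqAle u1 andbT; apply/eqP => e.
    have [m /nu //] : exists m, u = a1 *+ m.
    by apply: cdet_eq0_multiple => //=; lia.
  have v3 : 0 < cdet v a2.
    rewrite lt_neqAle v2 andbT; apply/eqP => e.
    have [m /nv //] : exists m, v = a2 *+ m.
    apply: cdet_eq0_multiple => //=; first by rewrite /coprimez gcdzC.
      by lia.
    by move: e; rewrite /cdet /=; lia.
  (* Since [u] is off the first ray and [v] off the second, [u + v] has both determinants at least
     1; the multiple d_1 + d_2 raises them above d_1 and d_2. *)
  exists (`|x1 - y1| + `|y2 - x2|)%N; apply/HP.
  rewrite (_ : cdet a1 (_ - b) =
    (`|x1 - y1| + `|y2 - x2|)%N%:Z * cdet a1 (u + v) - (x1 - y1)); last first.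
    by rewrite -cdetMn /cdet /=; ring.
  rewrite (_ : cdet (_ - b) a2 =
    (`|x1 - y1| + `|y2 - x2|)%N%:Z * cdet (u + v) a2 - (y2 - x2)); last first.
    by rewrite -cdetMnl /cdet /=; ring.
  rewrite cdetDr cdetDl PoszD !gez0_abs; try lia.
  move: (cdet a1 u) (cdet a1 v) (cdet u a2) (cdet v a2) u1 u2 v1 v2 u3 v3.
  by move=> *; nia.
- by move=> v [v1 v2 _]; apply/HP; split; apply: ltW.
- by split; apply/HP; rewrite /cdet /=; nia.
- by split; case; lia.
- by case; lia.
Qed.

(** A sum p + q inside a parallelogram is a base point, and q is a nonzero element of H. Conversely,
    a step [h] between cells that ends at a base point has determinant and coordinate difference
    strictly between 0 and d, so [h] lies in the parallelogram itself. *)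
Lemma indecomposableP :
  (forall j j' n h, monoid_set H h -> h <> 0 -> cell_pt j 0 <> cell_pt j' n + h)
  <-> strip_sumfree x1 y1 /\ strip_sumfree y2 x2.
Proof.
split=> [ind|[sf1 sf2]].
- split=> p q p1 p2 q1 q2 [r1 r2].
  + have stq : strip1 q by split; lia.
    have Hq : monoid_set H q.
      by apply/HP; have := strip1_far stq; lia.
    have /(in_stripP y1_ge0 yx1 co1)[i [n e]] : strip1 p by split; lia.
    have : strip1 (p + q).
      by move: r1 r2 => /andP[r1 _] /andP[]; rewrite subr_gt0 in r1; split.
    move=> /(in_stripP y1_ge0 yx1 co1)[i' [n' e']].
    have n'0 : n' = 0%N.
      move: r1; rewrite e' Z2_mulrnE /=; nia.
    apply: (ind (inl i') (inl i) n q Hq).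
      by move=> q0; move: q2; rewrite q0 /cdet /=; lia.
    by rewrite /= -e e' n'0.
  + have stq : strip2 (swap (swap q)) by rewrite swapK; split; lia.
    have Hq : monoid_set H (swap q).
      by apply/HP; have := strip2_far stq; rewrite -strip2_cdet swapK; lia.
    have /(in_stripP x2_ge0 xy2 co2)[i [n e]] : strip2 p by split; lia.
    have : strip2 (p + q).
      by move: r1 r2 => /andP[r1 _] /andP[]; rewrite subr_gt0 in r1; split.
    move=> /(in_stripP x2_ge0 xy2 co2)[i' [n' e']].
    have n'0 : n' = 0%N.
      move: r1; rewrite e' Z2_mulrnE /=; nia.
    apply: (ind (inr i') (inr i) n (swap q) Hq).
      by move=> q0; move: q2; rewrite -[q]swapK q0 /cdet /=; lia.
    apply: (can_inj swapK); rewrite swapD swapK !swap_cell_pt -e e' n'0.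
    by rewrite mulr0n.
- move=> j j' n h Hh h0 /esym e.
  have [p0 q0] := monoid_nneg Hh; have /HP[h1 h2] := Hh.
  have [ed n0 mv] := cell_pt_move Hh e.
  have {}n0 : n = 0%N by lia.
  have {}mv : (cell_lev j' < cell_lev j)%N.
    case: mv => // -[_ eh]; exfalso; apply: h0.
    by rewrite eh sub0n mulr0n.
  case: j j' e ed mv => i [] i' e ed /= mv; try by case: ed; lia.
  + move: e; rewrite /= n0 !mulr0n !addr0 => e.
    have [_ b1 b2] := strip_base_in y1_ge0 yx1 co1 i.
    have [_ b1' b2'] := strip_base_in y1_ge0 yx1 co1 i'.
    have el := congr1 (cdet a1) e; rewrite cdetDr in el.
    have li := ltn_ord i; have li' := ltn_ord i'.
    have dh : h.1 - h.2 = i.+1%:Z - i'.+1%:Z.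
      by rewrite -(strip_base_diff i) -(strip_base_diff i') -e /=; lia.
    have lt : h.2 < h.1.
      by apply: (@diff_gt0_of_cdet_small x1 y1) => //; lia.
    rewrite /= in mv.
    apply: (sf1 (base1 i') h); rewrite ?e ?strip_base_diff; try lia.
  + have {}e : base2 i' + swap h = base2 i.
      have := congr1 swap e; rewrite swapD !swap_cell_pt n0 !mulr0n !addr0.
      by [].
    have [_ b1 b2] := strip_base_in x2_ge0 xy2 co2 i.
    have [_ b1' b2'] := strip_base_in x2_ge0 xy2 co2 i'.
    have el := congr1 (cdet (y2, x2)) e; rewrite cdetDr in el.
    have li := ltn_ord i; have li' := ltn_ord i'.
    have dh : (swap h).1 - (swap h).2 = i.+1%:Z - i'.+1%:Z.
      by rewrite -(strip_base_diff i) -(strip_base_diff i') -e /=; lia.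
    have hn0 : swap h <> 0 by move=> sh; apply: h0; rewrite -[h]swapK sh.
    have h2' : 0 <= cdet (y2, x2) (swap h) by rewrite strip2_cdet.
    have lt : (swap h).2 < (swap h).1.
      by apply: (@diff_gt0_of_cdet_small y2 x2) => //; lia.
    rewrite /= in mv.
    apply: (sf2 (base2 i') (swap h)); rewrite ?e ?strip_base_diff; try lia.
Qed.

End Cells.

(** * Coefficients in the semigroup ring *)

(** It allows convolution sums over any finite list that covers the nonzero terms. *)
Lemma sum_cover (T : eqType) (V : nmodType) (s1 s2 : seq T) (F : T -> V) :
  uniq s1 -> uniq s2 -> (forall u, F u <> 0 -> u \in s1) ->
  (forall u, F u <> 0 -> u \in s2) -> \sum_(u <- s1) F u = \sum_(u <- s2) F u.
Proof.
move=> u1 u2 c1 c2; rewrite (bigID (fun u => F u != 0)) /=.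
rewrite [X in _ + X]big1 => [|u /negPn/eqP //].
rewrite [RHS](bigID (fun u => F u != 0)) /= [X in _ = _ + X]big1 => [|u /negPn/eqP //].
rewrite !addr0 -!(big_filter _ (fun u => F u != 0)); apply: perm_big.
apply: uniq_perm; rewrite ?filter_uniq // => u; rewrite !mem_filter.
by case: eqP => //= Fu; rewrite c1 ?c2.
Qed.

Definition expm (v : Z2) : 'X_{1..2} :=
  [multinom (if i == ord0 then `|v.1|%N else `|v.2|%N) | i < 2].

Lemma mexpK m : expm (mexp m) = m.
Proof.
apply/mnmP => i; rewrite mnmE /=; case: eqP => [->//|i0].
by congr (m _); apply: val_inj; case: i i0 => -[|[|]] //= lt []; apply: val_inj.
Qed.

Lemma expmK v : 0 <= v.1 -> 0 <= v.2 -> mexp (expm v) = v.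
Proof. by case: v => p q /= p0 q0; rewrite /mexp !mnmE /= !gez0_abs. Qed.

Lemma mexp_inj : injective mexp. Proof. exact: can_inj mexpK. Qed.

Lemma mexpD m n : mexp (m + n)%MM = mexp m + mexp n.
Proof. by rewrite /mexp !mnmDE !PoszD. Qed.

Section MonomialCoefficients.
Variable K : fieldType.
Implicit Types p q : {mpoly K[2]}.

Lemma xpowE h : xpow K h = 'X_[expm h].
Proof.
rewrite mpolyXE_id !big_ord_recl big_ord0 mulr1 /xpow !mnmE /=.
by congr (_ * _ ^+ _); congr ('X__); apply: val_inj.
Qed.

(** Extended by zero to Z^2, so that coefficients at differences make sense; the guard is needed
    because [expm] takes absolute values. *)
Definition zcoef p (v : Z2) : K :=
  if (0 <= v.1) && (0 <= v.2) then p@_(expm v) else 0.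

Lemma zcoef_mexp p m : zcoef p (mexp m) = p@_m.
Proof. by rewrite /zcoef /= mexpK. Qed.

Lemma zcoefD p q v : zcoef (p + q) v = zcoef p v + zcoef q v.
Proof. by rewrite /zcoef; case: ifP; rewrite ?mcoeffD ?addr0. Qed.

Lemma zcoef0 v : zcoef 0 v = 0.
Proof. by rewrite /zcoef mcoeff0 if_same. Qed.

Lemma zcoefZ c p v : zcoef (c *: p) v = c * zcoef p v.
Proof. by rewrite /zcoef; case: ifP; rewrite ?mcoeffZ ?mulr0. Qed.

Lemma zcoef_neq0 p v : zcoef p v <> 0 -> exists2 m, m \in msupp p & v = mexp m.
Proof.
rewrite /zcoef; case: ifP => // /andP[v1 v2] pv; exists (expm v).
  by rewrite mcoeff_msupp; apply/eqP.
by rewrite expmK.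
Qed.

Lemma zcoef_inj p q : zcoef p =1 zcoef q -> p = q.
Proof. by move=> e; apply/mpolyP => m; rewrite -!zcoef_mexp. Qed.

Lemma zcoefX h v : 0 <= h.1 -> 0 <= h.2 -> zcoef 'X_[expm h] v = (v == h)%:R.
Proof.
move=> h1 h2; rewrite /zcoef; case: ifP => [/andP[v1 v2]|vn].
  rewrite mcoeffX; congr (_%:R); congr (nat_of_bool _).
  by apply/eqP/eqP => [e|->//]; rewrite -(expmK h1 h2) -(expmK v1 v2) e.
by case: eqP => // e; move: vn; rewrite e h1 h2.
Qed.

Lemma zcoefXM m q v : zcoef ('X_[m] * q) v = zcoef q (v - mexp m).
Proof.
rewrite [_ * q]mulrC /zcoef; case: ifP => [/andP[v1 v2]|vn].
  have [le|nle] := boolP (m <= expm v)%MM.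
    have ev : v = mexp m + mexp (expm v - m).
      by rewrite -mexpD addmC submK // expmK.
    rewrite {2 3 4}ev addrC addKr /= mexpK.
    by rewrite -{1}(submK le) addmC mcoeffMX.
  rewrite ifN.
    apply/eqP; rewrite mcoeff_eq0; apply: contra nle => /msuppM_le/allpairsP.
    move=> [[m1 m2] /= [_ m2X ->]]; move: m2X; rewrite msuppX inE => /eqP ->.
    by apply/mnm_lepP => i; rewrite mnmDE leq_addl.
  apply: contra nle => /=; rewrite !subr_ge0 => /andP[l1 l2].
  apply/mnm_lepP => i; rewrite mnmE; case: eqP => [->|i0]; first by lia.
  have -> : i = ord_max.
    by apply: val_inj; case: i i0 => -[|[|]] //= lt []; apply: val_inj.
  by lia.
rewrite ifN //; apply: contraFN vn => /=; rewrite !subr_ge0 => /andP[l1 l2].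
by apply/andP; split; lia.
Qed.

Lemma zcoefM p q v (L : seq Z2) : uniq L ->
  (forall u, zcoef p u * zcoef q (v - u) <> 0 -> u \in L) ->
  zcoef (p * q) v = \sum_(u <- L) zcoef p u * zcoef q (v - u).
Proof.
move=> uL cL; transitivity (\sum_(u <- [seq mexp m | m <- msupp p])
    zcoef p u * zcoef q (v - u)).
  rewrite big_map {1}(mpolyE p) mulr_suml.
  rewrite (big_morph (fun p => zcoef p v) (fun p q => zcoefD p q v) (zcoef0 v)).
  by apply: eq_bigr => m _; rewrite -scalerAl zcoefZ zcoefXM zcoef_mexp.
apply: sum_cover => //; first by rewrite map_inj_uniq ?msupp_uniq //; apply: mexp_inj.
move=> u pq; have [m mp ->] : exists2 m, m \in msupp p & u = mexp m.
  by apply: zcoef_neq0 => p0; apply: pq; rewrite p0 mul0r.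
exact: map_f.
Qed.

Lemma zcoef_span S p :
  p \in monomial_span K S <-> (forall v, zcoef p v <> 0 -> S v).
Proof.
split=> [/monomial_spanP Sp v /zcoef_neq0[m mp ->]|Sp]; first exact: Sp.
apply/monomial_spanP => m mp; apply: Sp; rewrite zcoef_mexp.
by apply/eqP; rewrite -mcoeff_msupp.
Qed.

End MonomialCoefficients.

Section SemigroupRingCoefficients.
Variables (K : fieldType) (H : monoidN2).
Local Notation A := (semigroup_ring K H).

Definition scoef (f : A) : Z2 -> K := zcoef (to_mpoly f).

Lemma scoefD f g v : scoef (f + g) v = scoef f v + scoef g v.
Proof. by rewrite /scoef to_mpolyD zcoefD. Qed.

Lemma scoef0 v : scoef 0 v = 0.
Proof. by rewrite /scoef to_mpoly0 zcoef0. Qed.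

Lemma scoefB f g v : scoef (f - g) v = scoef f v - scoef g v.
Proof. by apply/eqP; rewrite eq_sym subr_eq -scoefD subrK. Qed.

Lemma scoef_neq0 f v : scoef f v <> 0 -> monoid_set H v.
Proof.
by have /zcoef_span Hf : to_mpoly f \in monomial_span K H := valP f; apply: Hf.
Qed.

Lemma scoef_inj f g : scoef f =1 scoef g -> f = g.
Proof. by move=> /zcoef_inj e; apply: val_inj. Qed.

Lemma scoefM f g v (L : seq Z2) : uniq L ->
  (forall u, scoef f u * scoef g (v - u) <> 0 -> u \in L) ->
  scoef (f * g) v = \sum_(u <- L) scoef f u * scoef g (v - u).
Proof. by rewrite /scoef to_mpolyM; apply: zcoefM. Qed.

Lemma scoef_fin f : exists2 L, uniq L & forall u, scoef f u <> 0 -> u \in L.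
Proof.
exists [seq mexp m | m <- msupp (to_mpoly f)].
  by rewrite map_inj_uniq ?msupp_uniq //; apply: mexp_inj.
by move=> u /zcoef_neq0[m mf ->]; apply: map_f.
Qed.

(** [insubd] makes this total: the value is 0 if the monomial lies outside the ring. *)
Definition smon (c : K) (h : Z2) : A :=
  insubd (0 : A) (c *: 'X_[expm h] : {mpoly K[2]}).

Lemma smon_mpoly c h : monoid_set H h -> to_mpoly (smon c h) = c *: 'X_[expm h].
Proof.
move=> Hh; have [h1 h2] := monoid_nneg Hh.
rewrite /to_mpoly /smon insubdK //; apply/zcoef_span => v.
by rewrite zcoefZ zcoefX //; case: eqP => [->|]; rewrite ?mulr0.
Qed.

Lemma scoef_smon c h v : monoid_set H h -> scoef (smon c h) v = c * (v == h)%:R.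
Proof.
move=> Hh; have [h1 h2] := monoid_nneg Hh.
by rewrite /scoef smon_mpoly // zcoefZ zcoefX.
Qed.

Lemma smon1 : smon 1 0 = 1.
Proof.
apply: val_inj; rewrite -/(to_mpoly _) smon_mpoly; last exact: (monoid_submonoid H).1.
transitivity (1 : {mpoly K[2]}); last by [].
rewrite scale1r -mpolyX0; congr 'X_[_]; apply/mnmP => i.
by rewrite !mnmE /=; case: ifP.
Qed.

Lemma smonM c d g h : monoid_set H g -> monoid_set H h ->
  smon c g * smon d h = smon (c * d) (g + h).
Proof.
move=> Hg Hh; apply: scoef_inj => v.
rewrite (@scoefM _ _ _ [:: g]) //.
  rewrite big_seq1 !scoef_smon //; last exact: (monoid_submonoid H).2.
  by rewrite eqxx mulr1 mulrA subr_eq addrC eq_sym addrC eq_sym.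
by move=> u; rewrite scoef_smon // inE; case: eqP => //; rewrite mulr0 mul0r.
Qed.

Lemma monoid_opp_eq0 u : monoid_set H u -> monoid_set H (- u) -> u = 0.
Proof.
case: u => p q /monoid_nneg[/= p0 q0] /monoid_nneg[/= p1 q1].
by apply: injective_projections => /=; lia.
Qed.

(** H has no invertible element except 0, so the constant term is multiplicative. *)
Lemma scoefM0 f g : scoef (f * g) 0 = scoef f 0 * scoef g 0.
Proof.
rewrite (@scoefM _ _ _ [:: 0]) // ?big_seq1 ?subr0 // => u fg.
rewrite inE; apply/eqP/monoid_opp_eq0.
  by apply: (@scoef_neq0 f) => f0; apply: fg; rewrite f0 mul0r.
by apply: (@scoef_neq0 g) => f0; apply: fg; rewrite sub0r f0 mulr0.
Qed.

Local Notation m := (@graded_maximal_ideal K H).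

Lemma smon_maximal_ideal h : monoid_set H h -> h <> 0 -> m (smon 1 h).
Proof.
move=> Hh h0 M _; apply; exists h; split=> //.
by rewrite smon_mpoly // scale1r xpowE.
Qed.

Lemma maximal_ideal_sub (M : set A) : @is_submodule A A^o M ->
  (forall h, monoid_set H h -> h <> 0 -> M (smon 1 h)) ->
  forall f, m f -> M f.
Proof.
move=> sM Mh f mf; apply: mf => // g [h [Hh h0 e]].
suff -> : g = smon 1 h by apply: Mh.
by apply: val_inj; rewrite -/(to_mpoly g) e -/(to_mpoly _) smon_mpoly // scale1r xpowE.
Qed.

Lemma maximal_ideal_scoef0 f : m f -> scoef f 0 = 0.
Proof.
apply: (@maximal_ideal_sub [set f | scoef f 0 = 0]%classic) => [|h Hh h0] /=.
  split=> [|a u v /= u0 v0] /=; first exact: scoef0.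
  by rewrite scoefD -[a *: u]/(a * (u : A)) scoefM0 u0 v0 mulr0 addr0.
by rewrite scoef_smon //; case: eqP => [/esym//|_]; rewrite mulr0.
Qed.

End SemigroupRingCoefficients.

(** * Modules with a monomial basis *)

Local Open Scope classical_set_scope.
Local Open Scope ring_scope.

Section Submodules.
Variables (A : comNzRingType) (V : lmodType A).
Implicit Type M : set V.

Lemma submodule_add M u v : is_submodule M -> M u -> M v -> M (u + v).
Proof. by move=> [_ MD] Mu Mv; rewrite -[u]scale1r; apply: MD. Qed.

Lemma submodule_scale M a u : is_submodule M -> M u -> M (a *: u).
Proof. by move=> [M0 MD] Mu; rewrite -[a *: u]addr0; apply: MD. Qed.

Lemma submodule_sum M (I : Type) (r : seq I) (P : pred I) (F : I -> V) :
  is_submodule M -> (forall i, P i -> M (F i)) -> M (\sum_(i <- r | P i) F i).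
Proof.
move=> sM MF; apply: big_ind => //; first by case: sM.
by move=> u v; apply: submodule_add.
Qed.

Lemma span_submodule (X : set V) : is_submodule (Defs.span X).
Proof.
split=> [M [M0 _] _ //|a u v Xu Xv M sM XM].
by have [_ MD] := sM; apply: MD; [apply: Xu | apply: Xv].
Qed.

Lemma subset_span (X : set V) : X `<=` Defs.span X.
Proof. by move=> v Xv M _; apply. Qed.

Lemma ideal_mul_sub (I : set A) (M M' : set V) : is_submodule M' ->
  (forall a v, I a -> M v -> M' (a *: v)) -> ideal_mul I M `<=` M'.
Proof. by move=> sM' IM v; apply=> // x [a [w [Ia [Mw ->]]]]; apply: IM. Qed.

Lemma ideal_mul_mem (I : set A) (M : set V) a v :
  I a -> M v -> ideal_mul I M (a *: v).
Proof. by move=> Ia Mv; apply: subset_span; exists a, v. Qed.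

Lemma ideal_pow_submodule (I : set A) n : is_submodule (ideal_pow_mod (V := V) I n).
Proof.
case: n => [|n]; last exact: span_submodule.
by split.
Qed.

End Submodules.

Lemma chain_sup_inj (T : Type) (P : set (set T)) d d' :
  chain_sup P d -> chain_sup P d' -> d = d'.
Proof.
move=> [[c cd] dmax] [[c' cd'] dmax']; apply/eqP; rewrite eqn_leq.
by rewrite (dmax' _ _ cd) (dmax _ _ cd').
Qed.

(* The classes vm v, v in S, form a K-basis of V on which monomials act by
   translation (or by 0 when the translate leaves S); vc is the family of
   coordinates. *)
Record monomial_module (K : fieldType) (H : monoidN2) (S : set Z2)
  (V : lmodType (semigroup_ring K H)) (vc : V -> Z2 -> K) (vm : Z2 -> V) :
  Prop := {
  vcD : forall u v h, vc (u + v) h = vc u h + vc v h;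
  vc_out : forall v h, ~ S h -> vc v h = 0;
  vc_fin : forall v, exists2 L, uniq L & forall h, vc v h <> 0 -> h \in L;
  vc_eq0 : forall v, (forall h, vc v h = 0) -> v = 0;
  vc_vm : forall h g, S h -> vc (vm h) g = (g == h)%:R;
  vcZ : forall f v h L, S h -> uniq L ->
    (forall u, scoef f u * vc v (h - u) <> 0 -> u \in L) ->
    vc (f *: v) h = \sum_(u <- L) scoef f u * vc v (h - u) }.

Section MonomialModule.
Variables (K : fieldType) (H : monoidN2) (S : set Z2).
Local Notation A := (semigroup_ring K H).
Variables (V : lmodType A) (vc : V -> Z2 -> K) (vm : Z2 -> V).
Hypothesis VB : monomial_module S vc vm.

Lemma monoid0 : monoid_set H 0. Proof. exact: (monoid_submonoid H).1. Qed.
#[local] Hint Resolve monoid0 : core.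

Lemma vc0 h : vc 0 h = 0.
Proof. by apply: (addrI (vc 0 h)); rewrite -(vcD VB) !addr0. Qed.

Lemma vcN v h : vc (- v) h = - vc v h.
Proof. by apply: (addrI (vc v h)); rewrite -(vcD VB) !subrr vc0. Qed.

Lemma vcB u v h : vc (u - v) h = vc u h - vc v h.
Proof. by rewrite (vcD VB) vcN. Qed.

Lemma vc_inj u v : vc u =1 vc v -> u = v.
Proof.
move=> e; apply/eqP; rewrite -subr_eq0; apply/eqP/(vc_eq0 VB) => h.
by rewrite vcB e subrr.
Qed.

Lemma vc_sum (I : Type) (r : seq I) (P : pred I) (F : I -> V) h :
  vc (\sum_(i <- r | P i) F i) h = \sum_(i <- r | P i) vc (F i) h.
Proof. exact: (big_morph (fun v => vc v h) (fun u v => vcD VB u v h) (vc0 h)). Qed.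

Lemma vc_smon c h v g : monoid_set H h -> S g ->
  vc (smon H c h *: v) g = c * vc v (g - h).
Proof.
move=> Hh Sg; rewrite (@vcZ _ _ _ _ _ _ VB _ _ _ [:: h]) //.
  by rewrite big_seq1 scoef_smon // eqxx mulr1.
by move=> u; rewrite scoef_smon // inE; case: eqP => //; rewrite mulr0 mul0r.
Qed.

(** V is a module over K[H] only; K acts on it through the degree 0 monomials. *)
Lemma vc_const c v g : vc (smon H c 0 *: v) g = c * vc v g.
Proof.
have [Sg|nSg] := pselect (S g); first by rewrite vc_smon // subr0.
by rewrite !(vc_out VB) // mulr0.
Qed.

Lemma vm_shift h v : monoid_set H h -> S v -> S (v + h) ->
  smon H 1 h *: vm v = vm (v + h).
Proof.
move=> Hh Sv Svh; apply: vc_inj => g; have [Sg|nSg] := pselect (S g).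
  by rewrite vc_smon // mul1r !(vc_vm VB) // subr_eq.
by rewrite !(vc_out VB).
Qed.

Lemma vm_shift0 h v : monoid_set H h -> S v -> ~ S (v + h) ->
  smon H 1 h *: vm v = 0.
Proof.
move=> Hh Sv Svh; apply: (vc_eq0 VB) => g; have [Sg|nSg] := pselect (S g).
  rewrite vc_smon // mul1r (vc_vm VB) // subr_eq; case: eqP => // e.
  by case: Svh; rewrite -e.
by rewrite !(vc_out VB).
Qed.

Lemma vm_neq0 v : S v -> vm v <> 0.
Proof.
move=> Sv e; have := vc_vm VB v Sv; rewrite e vc0 eqxx => /esym/eqP.
by rewrite oner_eq0.
Qed.

Lemma submodule_vm (M : set V) z : is_submodule M ->
  (forall v, S v -> vc z v <> 0 -> M (vm v)) -> M z.
Proof.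
move=> sM Mvm; have [L uL cL] := vc_fin VB z.
have -> : z = \sum_(v <- L | vc z v != 0) smon H (vc z v) 0 *: vm v.
  apply: vc_inj => g; rewrite vc_sum.
  have [gz|gn] := eqVneq (vc z g) 0.
    rewrite gz big1_seq // => v /andP[vz _]; rewrite vc_const.
    rewrite (vc_vm VB); last by apply: contrapT => /(vc_out VB z)/eqP; apply/negP.
    case: (g =P v) vz => [<-|_ _]; first by rewrite gz eqxx.
    by rewrite mulr0.
  have gL : g \in L by apply: cL; apply/eqP.
  have Sh h : vc z h != 0 -> S h.
    by move=> hz; apply: contrapT => /(vc_out VB z)/eqP; apply/negP.
  rewrite big_mkcond (bigD1_seq g) //= gn vc_const (vc_vm VB) ?eqxx ?mulr1; last exact: Sh.
  rewrite big1 ?addr0 // => v vg; case: ifP => // vz.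
  by rewrite vc_const (vc_vm VB) 1?eq_sym ?(negPf vg) ?mulr0 //; apply: Sh.
apply: submodule_sum => // v /eqP vz; apply: submodule_scale => //.
apply: Mvm => //; apply: contrapT => /(vc_out VB z); exact: vz.
Qed.

Lemma vc_scale_eq0 f v h :
  (forall u, monoid_set H u -> scoef f u <> 0 -> S (h - u) -> vc v (h - u) = 0) ->
  vc (f *: v) h = 0.
Proof.
move=> v0; have [Sh|nSh] := pselect (S h); last exact: (vc_out VB).
have [L uL cL] := scoef_fin f.
rewrite (vcZ VB Sh uL) => [|u fv]; last first.
  by apply: cL => f0; apply: fv; rewrite f0 mul0r.
apply: big1 => u _; have [->|/eqP fu] := eqVneq (scoef f u) 0; first by rewrite mul0r.
have [Su|/(vc_out VB) ->] := pselect (S (h - u)); last by rewrite mulr0.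
by rewrite v0 ?mulr0 //; apply: scoef_neq0 fu.
Qed.

(** * Lengths of chains of submodules *)

(** The coordinate of f z at v involves only coordinates of z at v - u with u in H, so a set closed
    under such subtractions gives a submodule. *)
Lemma vanishing_submodule (B : set Z2) :
  (forall v u, B v -> monoid_set H u -> S (v - u) -> B (v - u)) ->
  is_submodule [set z | forall v, B v -> vc z v = 0].
Proof.
move=> dB; split=> [v _|a u w u0 w0 v Bv]; first exact: vc0.
rewrite (vcD VB) w0 // addr0; apply: vc_scale_eq0 => g Hg _ Sg.
by apply: u0; apply: dB.
Qed.

(** Pick [z i] new at each step of the chain. If there are more steps than coordinates [F], a
    nontrivial K-combination vanishes at all of [F] and so lies in [W]. *)
Lemma chain_length_le (I : finType) (F : I -> Z2) (W : set V) c L :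
  (forall z, (forall i, vc z (F i) = 0) -> W z) ->
  (forall i, (i <= L)%N -> is_submodule (c i) /\ W `<=` c i) ->
  (forall i, (i < L)%N -> c i `<` c i.+1) -> (L <= #|I|)%N.
Proof.
move=> FW csub cinc; rewrite leqNgt; apply/negP => ltL.
have /choice[z zP] : forall i : 'I_L, exists z, c i.+1 z /\ ~ c i z.
  move=> i.
  have [_ /existsNP[z /not_implyP[zi nzi]]] := cinc i (ltn_ord i).
  by exists z.
have mono i j : (i <= j)%N -> (j <= L)%N -> c i `<=` c j.
  elim: j => [|j IH]; first by rewrite leqn0 => /eqP -> _ v.
  rewrite leq_eqVlt => /predU1P[-> _ v //|ij] jL.
  exact: subset_trans (IH ij (ltnW jL)) (properW (cinc _ jL)).
pose Z := \matrix_(i < L, j < #|I|) vc (z i) (F (enum_val j)).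
have : kermx Z != 0.
  by rewrite kermx_eq0 /row_free neq_ltn (leq_ltn_trans (rank_leq_col Z)).
move=> /matrix0Pn[i0 [j0 uij]]; pose u i := kermx Z i0 i.
have uZ j : \sum_i u i * vc (z i) (F j) = 0.
  have := congr1 (fun M : 'M[K]_(L, #|I|) => M i0 (enum_rank j)) (mulmx_ker Z).
  rewrite [LHS]mxE [RHS]mxE => e; rewrite -[RHS]e; apply: eq_bigr => i _.
  by rewrite [Z _ _]mxE enum_rankK.
(* At the last nonzero coefficient, [z k] is expressed by [W] and earlier members, all in [c k],
   against its choice. *)
have [k /= uk kmax] := @arg_maxnP _ j0 (fun i => u i != 0) val uij.
have [sk Wk] := csub k (ltnW (ltn_ord k)).
pose w := \sum_i smon H (u i) 0 *: z i.
have cw : c k w.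
  apply: Wk; apply: FW => j; rewrite vc_sum -[RHS](uZ j).
  by apply: eq_bigr => i _; rewrite vc_const.
have [_] := zP k; apply.
have -> : z k = smon H (u k)^-1 0 *: (smon H (u k) 0 *: z k).
  by rewrite scalerA smonM // mulVf // addr0 smon1 scale1r.
apply: submodule_scale => //.
have -> : smon H (u k) 0 *: z k =
    w + smon H (-1) 0 *: (\sum_(i | i != k) smon H (u i) 0 *: z i).
  rewrite /w (bigD1 k) //= -addrA; apply: vc_inj => g.
  by rewrite !(vcD VB) !vc_const; ring.
apply: submodule_add => //; apply: submodule_scale => //.
apply: submodule_sum => // i ik.
have [ui|ui] := eqVneq (u i) 0.
  have -> : smon H (u i) 0 *: z i = 0.
    by apply: (vc_eq0 VB) => g; rewrite vc_const ui mul0r.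
  by case: sk.
apply: submodule_scale => //.
apply: (mono i.+1); [|exact: ltnW|by have [] := zP i].
by have := kmax i ui; rewrite leq_eqVlt => /predU1P[/val_inj/eqP|//]; rewrite (negPf ik).
Qed.

(* The chain adds the cells of s one by one, by decreasing total degree. *)
Lemma chain_exists (s : seq Z2) (W : set V) : uniq s ->
  (forall v, v \in s -> S v) ->
  (forall v u, v \in s -> monoid_set H u -> S (v - u) -> v - u \in s) ->
  W `<=` [set z | forall v, v \in s -> vc z v = 0] ->
  exists c, (forall i, (i <= size s)%N -> is_submodule (c i) /\ W `<=` c i) /\
    (forall i, (i < size s)%N -> c i `<` c i.+1).
Proof.
move=> us sS ds Ws; pose deg (v : Z2) := v.1 + v.2.
pose r := relpre deg (fun x y => y <= x).
have r_total : total r by move=> x y; rewrite /r /= le_total.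
have r_trans : transitive r by move=> y x z /= yx zy; apply: le_trans zy yx.
pose t := sort r s; have ut : uniq t by rewrite sort_uniq.
have et : size t = size s by rewrite size_sort.
have mt v : (v \in t) = (v \in s) by rewrite mem_sort.
have tle i j : (i <= j)%N -> (j < size t)%N -> deg (nth 0 t j) <= deg (nth 0 t i).
  move=> ij jt; have it := leq_ltn_trans ij jt.
  have rr : reflexive r by move=> x; rewrite /r /=.
  exact: (sorted_leq_nth r_trans rr 0 (sort_sorted r_total s) _ _ it jt ij).
(* The coordinates still required to vanish after i cells have been released. *)
pose B i := [set v | exists2 k, (i <= k < size t)%N & v = nth 0 t k].
exists (fun i => [set z | forall v, B i v -> vc z v = 0]); split=> i.
- move=> _; split; last first.
    move=> z /Ws z0 v [k /andP[_ kt] ->]; apply: z0.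
    by rewrite -mt mem_nth.
  apply: vanishing_submodule => v u [k /andP[ik kt] ->] Hu Su.
  have [->|/eqP u0] := eqVneq u 0; first by rewrite subr0; exists k; rewrite ?ik.
  have kin : nth 0 t k - u \in t by rewrite mt; apply: ds; rewrite // -mt mem_nth.
  exists (index (nth 0 t k - u) t); last by rewrite nth_index.
  (* Subtracting a nonzero element of H lowers the total degree, so the new cell stands later in [t]
     and [B i] is closed. *)
  rewrite index_mem kin andbT (leq_trans ik) // leqNgt; apply/negP => lt.
  have := tle _ _ (ltnW lt) kt; rewrite nth_index // /deg /=.
  have [p0 q0] := monoid_nneg Hu; move=> le; apply: u0.
  by apply: injective_projections => /=; lia.
- rewrite -et => it; split.
    by move=> z z0 v [k /andP[ik kt] ->]; apply: z0; exists k; rewrite // (ltnW ik).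
  have Si : S (nth 0 t i) by apply: sS; rewrite -mt mem_nth.
  move=> /(_ (vm (nth 0 t i))) /= c0.
  have : vc (vm (nth 0 t i)) (nth 0 t i) = 0.
    apply: c0; last by exists i; rewrite ?leqnn.
    move=> v [k /andP[ik kt] ->]; rewrite (vc_vm VB) // nth_uniq //.
    by rewrite gtn_eqF.
  by rewrite (vc_vm VB) // eqxx => /eqP; rewrite oner_eq0.
Qed.

(** [has_colength] wants an attained supremum; chain lengths are bounded, so a longest chain exists
    without an exact count. *)
Lemma colength_bounds (I : finType) (F : I -> Z2) (s : seq Z2) (W : set V) :
  (forall z, (forall i, vc z (F i) = 0) -> W z) -> uniq s ->
  (forall v, v \in s -> S v) ->
  (forall v u, v \in s -> monoid_set H u -> S (v - u) -> v - u \in s) ->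
  W `<=` [set z | forall v, v \in s -> vc z v = 0] ->
  exists l, has_colength W l /\ (size s <= l <= #|I|)%N.
Proof.
move=> FW us sS ds Ws.
pose chain c n := (forall i, (i <= n)%N -> is_submodule (c i) /\ W `<=` c i) /\
  (forall i, (i < n)%N -> c i `<` c i.+1).
pose P n := `[< exists c : nat -> set V, chain c n >].
have Ps : P (size s) by apply/asboolP; apply: chain_exists.
have Pmax n : P n -> (n <= #|I|)%N.
  by move=> /asboolP[c [c1 c2]]; apply: chain_length_le FW c1 c2.
have [l /asboolP[c cl] lmax] := ex_maxnP (ex_intro P _ Ps) Pmax.
exists l; split; last by rewrite lmax // Pmax //; apply/asboolP; exists c.
split=> [|c' n c'n]; first by exists c.
by apply: lmax; apply/asboolP; exists c'.
Qed.

End MonomialModule.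

(** * Multiplicity and number of generators *)

Section StripModule.
Variables (K : fieldType) (H : monoidN2) (b a1 a2 : Z2).
Variables (J : finType) (pt : J -> nat -> Z2) (dir : J -> Z2) (lev : J -> nat).
Hypothesis SD : strip_decomposition H b a1 a2 pt dir lev.
Local Notation A := (semigroup_ring K H).
Local Notation S := (cell H b a1 a2).
Variables (V : lmodType A) (vc : V -> Z2 -> K) (vm : Z2 -> V).
Hypothesis VB : monomial_module S vc vm.
Local Notation m := (@graded_maximal_ideal K H).
Local Notation N := #|J|.

Lemma cell_pt_in j n : S (pt j n).
Proof. by apply/(cellE SD); exists j, n. Qed.
#[local] Hint Resolve cell_pt_in : core.

Lemma dir_monoid j : monoid_set H (dir j).
Proof. by have [? ?] := ray_monoid SD; case: (dirE SD j) => ->. Qed.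

Lemma dir_neq0 j : dir j <> 0.
Proof. by have [? ?] := ray_neq0 SD; case: (dirE SD j) => ->. Qed.

Lemma ptD j n k : pt j n + dir j *+ k = pt j (n + k).
Proof. by rewrite (ptE SD j n) (ptE SD j (n + k)) mulrnDr addrA. Qed.

Lemma pt_sub j n u : monoid_set H u -> S (pt j n - u) ->
  exists j' n', [/\ pt j n - u = pt j' n', (n' <= n)%N &
    j' = j /\ u = dir j *+ (n - n') \/ (lev j' < lev j)%N].
Proof.
move=> Hu /(cellE SD)[j' [n' e]]; exists j', n'.
have [||nn' mv] := @pt_move _ _ _ _ _ _ _ _ SD j' n' j n u => //.
  by rewrite -e subrK.
by split=> //; case: mv => [[<- ->]|]; [left | right].
Qed.

Lemma vc_ptE z : (forall j n, vc z (pt j n) = 0) -> z = 0.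
Proof.
move=> z0; apply: (vc_eq0 VB) => h; have [/(cellE SD)[j [n ->]]|] := pselect (S h).
  exact: z0.
exact: (vc_out VB).
Qed.

Lemma vm_pt_step j n k :
  smon H 1 (dir j *+ k) *: vm (pt j n) = vm (pt j (n + k)) :> V.
Proof.
have Hk : monoid_set H (dir j *+ k).
  elim: k => [|k IH]; first exact: (monoid_submonoid H).1.
  by rewrite mulrS; apply: (monoid_submonoid H).2 => //; apply: dir_monoid.
by rewrite (vm_shift VB) ?ptD.
Qed.

Definition tail (n : nat) : set V :=
  [set z | forall j i, (i < n)%N -> vc z (pt j i) = 0].

Lemma vm_pow j n i :
  (n <= i)%N -> ideal_pow_mod m n (vm (pt j i)).
Proof.
elim: n i => [|n IH] [|i] // ni.
rewrite -[i.+1]addn1 -vm_pt_step mulr1n; apply: ideal_mul_mem; last exact: IH.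
exact: smon_maximal_ideal (dir_monoid j) (dir_neq0 (j := j)).
Qed.

Lemma tail_sub_pow n : tail n `<=` ideal_pow_mod m n.
Proof.
move=> z tz; apply: (submodule_vm VB) => [|v]; first exact: ideal_pow_submodule.
move=> /(cellE SD)[j [i ->]] zi; apply: vm_pow; rewrite leqNgt; apply/negP => lt.
by apply: zi; apply: tz.
Qed.

(* Each nonunit monomial raises the weight i + lev j of x^(pt j i). *)
Lemma pow_vanishing n : ideal_pow_mod m n `<=`
  [set z : V | forall j i, (i + lev j < n)%N -> vc z (pt j i) = 0].
Proof.
elim: n => [z _ j i //|n IH].
pose B k := [set v | exists j i, (i + lev j < k)%N /\ v = pt j i].
apply: (@subset_trans _ [set z | forall v, B n.+1 v -> vc z v = 0]); last first.
  by move=> z z0 j i ij; apply: z0; exists j, i.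
apply: ideal_mul_sub.
  apply: (vanishing_submodule VB) => v u [j [i [ij ->]]] Hu Su.
  have [j' [i' [-> le mv]]] := pt_sub Hu Su; exists j', i'; split=> //.
  by case: mv => [[-> _]|]; lia.
move=> f z mf /IH z0 v [j [i [ij ->]]]; apply: (vc_scale_eq0 VB) => u Hu fu Su.
have [j' [i' [-> le mv]]] := pt_sub Hu Su; apply: z0.
case: mv => [[-> eu]|]; last by lia.
have : i' <> i.
  by move=> e; apply: fu; rewrite eu e subnn mulr0n maximal_ideal_scoef0.
by lia.
Qed.

Lemma colength_pow n : exists l,
  has_colength (ideal_pow_mod (V := V) m n) l /\
  ((n - \max_j lev j) * N <= l <= n * N)%N.
Proof.
set d := \max_j lev j.
(* For i < n - d one has i + [lev j] < n, so every element of m^n V vanishes at these cells. *)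
pose s := [seq pt p.1 (val p.2) | p <- enum {: J * 'I_(n - d)}].
have ms v : v \in s <-> exists j i, (i < n - d)%N /\ v = pt j i.
  split=> [/mapP[[j i] _ ->]|[j [i [lt ->]]]]; first by exists j, i; split.
  by apply/mapP; exists (j, Ordinal lt); rewrite ?mem_enum.
have [||v /ms[j [i [_ ->]]]||z|l [cl lb]] := @colength_bounds _ _ _ _ _ _ VB
    (J * 'I_n)%type (fun p => pt p.1 (val p.2)) s (ideal_pow_mod m n).
- by move=> z z0; apply: tail_sub_pow => j i lt; apply: (z0 (j, Ordinal lt)).
- rewrite map_inj_uniq ?enum_uniq // => -[j i] [j' i'] /= /(pt_inj SD)[-> e].
  by congr (_, _); apply: val_inj.
- exact: cell_pt_in.
- move=> v u /ms[j [i [lt ->]]] Hu Su; apply/ms.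
  have [j' [i' [-> le _]]] := pt_sub Hu Su; exists j', i'; split=> //.
  exact: leq_ltn_trans le lt.
- move=> /pow_vanishing z0 v /ms[j [i [lt ->]]]; apply: z0.
  by have := @leq_bigmax _ lev j; rewrite -/d; lia.
- exists l; split=> //; move: lb; rewrite size_map -cardE !card_prod !card_ord.
  by rewrite ![(N * _)%N]mulnC.
Qed.

Lemma multiplicityE e : krull_dim V 1 -> multiplicity V m e <-> e = N%:R.
Proof.
move=> kd; set d := \max_j lev j.
(* The colength differs from n N by at most d N, which after division by n leaves an error of at
   most d N / n. *)
have key (l : nat -> nat) (n : nat) :
    (forall n, has_colength (ideal_pow_mod (V := V) m n) (l n)) -> (0 < n)%N ->
    `|(1`! * l n)%:R / n%:R ^+ 1 - N%:R| <= (d * N)%:R / n%:R :> rat.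
  move=> cl n0; have [l' [cl' lb]] := colength_pow n.
  have el : l n = l' := chain_sup_inj (cl n) cl'.
  have n0' : (0 : rat) < n%:R by rewrite ltr0n.
  rewrite (_ : 1`! = 1)%N // mul1n expr1 el -{1}(mulfK (lt0r_neq0 n0') N%:R) -mulrBl.
  rewrite normrM normfV (gtr0_norm n0') ler_pM2r ?invr_gt0 //.
  rewrite distrC ger0_norm ?subr_ge0 -natrM ?ler_nat; last by case/andP: lb; lia.
  by rewrite lerBlDr -natrD ler_nat; case/andP: lb; rewrite -/d; nia.
have small (eps : rat) : 0 < eps -> exists M, forall n, (M < n)%N ->
    (0 < n)%N /\ (d * N)%:R / n%:R < eps.
  move=> e0; exists (Num.bound ((d * N)%:R / eps)) => n lt.
  have n0 : (0 < n)%N := leq_ltn_trans (leq0n _) lt.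
  split=> //; rewrite ltr_pdivrMr ?ltr0n // mulrC -ltr_pdivrMr //.
  apply: lt_trans (_ : _ < (Num.bound ((d * N)%:R / eps))%:R) _.
    by apply: archi_boundP; rewrite divr_ge0 // ltW.
  by rewrite ltr_nat.
split=> [[k [l [kd' cl lim]]]|->].
- have ek : k = 1%N := chain_sup_inj kd' kd; move: lim; rewrite ek => lim.
  apply/eqP; rewrite -subr_eq0 -normr_eq0 eq_le normr_ge0 andbT leNgt.
  apply/negP => e0; pose eps := `|e - N%:R| / 2.
  have eps0 : 0 < eps by rewrite divr_gt0.
  have [M1 P1] := lim _ eps0; have [M2 P2] := small _ eps0.
  have {}P1 := P1 (M1 + M2).+1 ltac:(lia).
  have [n0 {}P2] := P2 (M1 + M2).+1 ltac:(lia).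
  have P3 := key l _ cl n0.
  have : `|e - N%:R| < eps + eps; last by rewrite /eps -splitr ltxx.
  set x := _ / _ in P1 P3; rewrite -(subrK x e) -addrA.
  apply: le_lt_trans (ler_normD _ _) _; rewrite distrC.
  by apply: ltrD => //; apply: le_lt_trans P3 P2.
- have [l lP] := choice colength_pow; exists 1%N, l; split=> //.
    by move=> n; have [] := lP n.
  move=> eps /small[M PM]; exists M => n /PM[n0 lt].
  by apply: le_lt_trans lt; apply: key => // k; have [] := lP k.
Qed.

Definition indecomposable := forall j j' n h, monoid_set H h -> h <> 0 ->
  pt j 0%N <> pt j' n + h.

Lemma span_vmT (X : set V) : (forall j, Defs.span X (vm (pt j 0%N))) ->
  Defs.span X = setT.
Proof.
move=> Xg; apply/seteqP; split=> // z _.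
apply: (submodule_vm VB (M := Defs.span X)) => [|v /(cellE SD)[j [n ->]] _].
  exact: span_submodule.
by rewrite -[n]add0n -vm_pt_step; exact: submodule_scale (span_submodule X) _.
Qed.

(** [vec] plays the role of V -> V / m V: if no nonzero element of H leads from a cell to a base
    point, then f acts on base coordinates by its constant term. Generators therefore span K^N. *)
Lemma gens_size (s : seq V) : indecomposable ->
  Defs.span [set v | v \in s] = setT -> (N <= size s)%N.
Proof.
move=> ind sT; pose vec (z : V) := \row_(j < N) vc z (pt (enum_val j) 0%N).
pose Mx := \matrix_(i < size s) vec s`_i.
have lin f z w : vec (f *: z + w) = scoef f 0 *: vec z + vec w.
  apply/rowP => j; rewrite !mxE (vcD VB); congr (_ + _).
  rewrite (@vcZ _ _ _ _ _ _ VB _ _ _ [:: 0]) //.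
    by rewrite big_seq1 subr0.
  move=> u fu; rewrite inE; apply/eqP; apply: contrapT => u0; apply: fu.
  have [->|/eqP fu'] := eqVneq (scoef f u) 0; first by rewrite mul0r.
  rewrite (vc_out VB) ?mulr0 // => /(cellE SD)[j' [n' e]].
  by apply: (ind (enum_val j) j' n' u) => //; [apply: scoef_neq0 fu'|rewrite -e subrK].
have sub z : (vec z <= Mx)%MS.
  have sz : Defs.span [set v | v \in s] z by rewrite sT.
  apply: (sz [set z | (vec z <= Mx)%MS]); last first.
    move=> v /= vs; have lt : (index v s < size s)%N by rewrite index_mem.
    suff -> : vec v = row (Ordinal lt) Mx by apply: row_sub.
    by rewrite rowK /= nth_index.
  split=> [|f u w us ws] /=.
    have -> : vec 0 = 0 by apply/rowP => j; rewrite !mxE (vc0 VB).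
    exact: sub0mx.
  by rewrite lin addmx_sub // scalemx_sub.
have : row_full Mx.
  rewrite -sub1mx; apply/row_subP => j.
  suff <- : vec (vm (pt (enum_val j) 0%N)) = row j 1%:M by [].
  apply/rowP => k; rewrite !mxE (vc_vm VB) //; congr (_%:R); congr nat_of_bool.
  by apply/eqP/eqP => [/(pt_inj SD)[/enum_val_inj ->]|->].
by rewrite /row_full => /eqP <-; apply: rank_leq_row.
Qed.

Lemma min_number_gensP : min_number_gens V N <-> indecomposable.
Proof.
split=> [[_ gmin] j j' n h Hh h0 e|ind].
- have [n0 mv] : n = 0%N /\ (lev j' < lev j)%N.
    have [n0 [[_ eh]|lt]] := pt_move SD Hh (esym e); last by split=> //; lia.
    by case: h0; rewrite eh sub0n mulr0n.
  pose s := [seq vm (pt i 0%N) | i <- rem j (enum J)].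
  have : (N <= size s)%N.
    apply: gmin; apply: span_vmT => i.
    have others k : k != j -> Defs.span [set v | v \in s] (vm (pt k 0%N)).
      move=> kj; apply: subset_span => /=; apply: map_f.
      by rewrite mem_rem_uniq ?enum_uniq // inE kj mem_enum.
    have [->|/others//] := eqVneq i j.
    have -> : vm (pt j 0%N) = smon H 1 h *: vm (pt j' n).
      by rewrite (vm_shift VB) -?e.
    rewrite n0; apply: submodule_scale (span_submodule _) _.
    by apply: others; apply: contraTneq mv => ->; rewrite ltnn.
  have j0 : (0 < N)%N by apply/card_gt0P; exists j.
  rewrite size_map size_rem ?mem_enum // -cardE.
  by case: N j0 => //= k _; rewrite ltnn.
- split=> [|s]; last exact: gens_size.
  exists [seq vm (pt j 0%N) | j <- enum J]; split; last by rewrite size_map -cardE.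
  by apply: span_vmT => j; apply: subset_span => /=; apply: map_f; rewrite mem_enum.
Qed.

End StripModule.

(** * Depth *)

Lemma ideal_mul_nil (A : comNzRingType) (V : lmodType A) (v : V) :
  ideal_mul [set a : A | a \in [::]] [set: V] v -> v = 0.
Proof.
apply: (ideal_mul_sub (M' := [set v | v = 0])) => // .
by split=> [|a u w /= -> ->] //=; rewrite scaler0 addr0.
Qed.

Lemma ideal_mul_seq1 (A : comNzRingType) (V : lmodType A) (a : A) (v : V) :
  ideal_mul [set x : A | x \in [:: a]] [set: V] v <-> exists w, v = a *: w.
Proof.
split=> [|[w ->]]; last by apply: ideal_mul_mem => //=; rewrite inE.
apply: (ideal_mul_sub (M' := [set v | exists w, v = a *: w])).
  split=> [|x u w /= [u' ->] [w' ->]]; first by exists 0; rewrite scaler0.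
  by exists (x *: u' + w'); rewrite scalerDr !scalerA mulrC.
by move=> x w /=; rewrite inE => /eqP -> _; exists w.
Qed.

Section Depth.
Variables (K : fieldType) (H : monoidN2) (b a1 a2 : Z2).
Variables (J : finType) (pt : J -> nat -> Z2) (dir : J -> Z2) (lev : J -> nat).
Hypothesis SD : strip_decomposition H b a1 a2 pt dir lev.
Local Notation A := (semigroup_ring K H).
Local Notation S := (cell H b a1 a2).
Variables (V : lmodType A) (vc : V -> Z2 -> K) (vm : Z2 -> V).
Hypothesis VB : monomial_module S vc vm.
Local Notation m := (@graded_maximal_ideal K H).

Definition ray_sum : A := smon H 1 a1 + smon H 1 a2.
Local Notation T := ray_sum.

(** If the difference were a cell, adding [a] back would either leave the cells or stay in a strip
    of direction [a]. *)
Lemma vc_sub_other z j n a : a = a1 \/ a = a2 -> a <> dir j ->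
  vc z (pt j n - a) = 0.
Proof.
move=> ea ne; apply: (vc_out VB) => /(cellE SD)[j' [n' e]].
have [ej|nj] := pselect (a = dir j'); last first.
  by apply: (dir_other SD ea nj (n := n')); rewrite -e subrK; apply: cell_pt_in SD _ _.
apply: ne; rewrite ej; have : pt j n = pt j' n'.+1.
  by rewrite -addn1 -(ptD SD) mulr1n -e ej subrK.
by move=> /(pt_inj SD)[->].
Qed.

Lemma vc_ray_sum z j n : vc (T *: z) (pt j n) = vc z (pt j n - dir j).
Proof.
have [Ha1 Ha2] := ray_monoid SD; have ne := ray_neq SD.
rewrite scalerDl (vcD VB) !(vc_smon VB) ?mul1r //; try exact: cell_pt_in SD _ _.
case: (dirE SD j) => e; rewrite e.
  by rewrite (@vc_sub_other z j n a2) ?addr0 ?e //; [right | move/esym].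
by rewrite (@vc_sub_other z j n a1) ?add0r ?e //; left.
Qed.

Lemma vc_ray_sumS z j n : vc (T *: z) (pt j n.+1) = vc z (pt j n).
Proof. by rewrite vc_ray_sum -addn1 -(ptD SD) mulr1n addrK. Qed.

Lemma vc_ray_sum0 z j : vc (T *: z) (pt j 0%N) = 0.
Proof.
rewrite vc_ray_sum; apply: (vc_out VB) => S0.
have [j' [n' [e n0 mv]]] := pt_sub SD (dir_monoid SD j) S0.
have : pt j' n'.+1 = pt j 0%N \/ dir j' <> dir j.
  have [ed|] := pselect (dir j' = dir j); [left|by right].
  by rewrite -addn1 -(ptD SD) mulr1n -e ed subrK.
case=> [/(pt_inj SD)[_ //]|ne].
apply: (dir_other SD (dirE SD j) (nesym ne) (n := n')).
by rewrite -e subrK; apply: cell_pt_in SD _ _.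
Qed.

Lemma ray_sum_inj (z w : V) : T *: z = T *: w -> z = w.
Proof.
move=> e; apply/eqP; rewrite -subr_eq0; apply/eqP/(vc_ptE SD VB) => j n.
by rewrite -vc_ray_sumS scalerBr e subrr (vc0 VB).
Qed.

Lemma ray_sum_maximal : m T.
Proof.
have [Ha1 Ha2] := ray_monoid SD; have [a10 a20] := ray_neq0 SD.
by apply: (@submodule_add A A^o m _ _ (span_submodule _));
  apply: smon_maximal_ideal.
Qed.

Lemma vm_notin_ray_sum j z : vm (pt j 0%N) <> T *: z.
Proof.
move=> e; have := vc_ray_sum0 z j; rewrite -e (vc_vm VB) ?eqxx.
  by move/eqP; rewrite oner_eq0.
exact: cell_pt_in SD _ _.
Qed.

(** From the highest level, a nonzero h in H can only kill the base vector or move it along its ray;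
    the latter results are multiples of T. *)
Lemma ray_sum_socle j : (forall i, lev i <= lev j)%N ->
  forall f, m f -> exists u, f *: vm (pt j 0%N) = T *: u.
Proof.
move=> jmax; apply: maximal_ideal_sub.
  split=> [|f u w /= [u' e] [w' e']]; first by exists 0; rewrite scale0r scaler0.
  exists (f *: u' + w'); rewrite scalerDl -scalerA e e' scalerDr !scalerA.
  by rewrite mulrC.
move=> h Hh h0 /=; have Sj := cell_pt_in SD j 0.
have [/[dup] Sh /(cellE SD)[j' [n' e]]|nS] := pselect (S (pt j 0%N + h)); last first.
  by exists 0; rewrite scaler0 (vm_shift0 VB).
have [_ [[_ eh]|]] := pt_move SD Hh e; last by rewrite ltnNge jmax.
have [n en] : exists n, h = dir j *+ n.+1.
  by case: n' {e} eh => [|n] eh; [case: h0 | exists n; rewrite eh].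
(* T shifts by one step, so the preimage of position n + 1 is position n. *)
exists (vm (pt j n)); apply: (vc_inj VB) => g.
have [/(cellE SD)[i [k ->]]|ng] := pselect (S g); last by rewrite !(vc_out VB).
rewrite en (vm_pt_step SD VB) add0n.
case: k => [|k].
  rewrite vc_ray_sum0 (vc_vm VB); last exact: cell_pt_in SD _ _.
  by case: eqP => // /(pt_inj SD)[].
rewrite vc_ray_sumS !(vc_vm VB); try exact: cell_pt_in SD _ _.
congr (nat_of_bool _)%:R; apply/eqP/eqP => /(pt_inj SD)[-> e'].
  by congr (pt _ _); apply: succn_inj.
by rewrite e'.
Qed.

(* With T = x^a1 + x^a2 and e in the socle modulo T V, a regular sequence f, g
   in m would give f e = T u and g e = T w, hence g u = f w, so u = f v for
   some v, and then e = T v. *)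
Lemma depth1 (j0 : J) : depth V m 1.
Proof.
split.
  exists [:: T]; split=> //; split; last first.
    by move=> f; rewrite inE => /eqP ->; apply: ray_sum_maximal.
  split=> [[|k] v //= _|/=].
    move=> /ideal_mul_nil e.
    have -> : v = 0 by apply: ray_sum_inj; rewrite e scaler0.
    exact: (span_submodule _).1.
  move=> e; have : [set: V] (vm (pt j0 0%N)) by [].
  by rewrite -e => /ideal_mul_seq1[w]; apply: vm_notin_ray_sum.
move=> [|f [|g s]] // [[reg _] ms].
have [j _ jmax] := @arg_maxnP _ j0 xpredT lev isT.
have {}jmax i : (lev i <= lev j)%N by apply: jmax.
have [u fu] := ray_sum_socle jmax (ms f (mem_head _ _)).
have [w gw] := ray_sum_socle jmax (ms g ltac:(by rewrite !inE eqxx orbT)).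
have f_inj (v : V) : f *: v = 0 -> v = 0.
  move=> fv; have := reg 0%N v isT; rewrite /= fv => reg0.
  exact: ideal_mul_nil (reg0 (span_submodule _).1).
have gu : g *: u = f *: w.
  apply: ray_sum_inj; rewrite !scalerA ![T * _]mulrC -!scalerA -fu -gw.
  by rewrite !scalerA mulrC.
have /ideal_mul_seq1[v uv] : ideal_mul [set x | x \in [:: f]] [set: V] u.
  have := reg 1%N u isT; rewrite /= ?take0; apply.
  by apply/ideal_mul_seq1; exists w.
exfalso; apply: (@vm_notin_ray_sum j v); apply/eqP; rewrite -subr_eq0.
apply/eqP/f_inj; rewrite scalerBr fu uv !scalerA mulrC subrr //.
Qed.

End Depth.

(** * Prime ideals and polynomials along a ray *)

Lemma Z2_mulrn_eq0 (a : Z2) n : a <> 0 -> a *+ n = 0 -> n = 0%N.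
Proof.
rewrite Z2_mulrnE; case: a => p q a0 [e1 e2]; apply: contrapT => n0; apply: a0.
by apply: injective_projections => /=; nia.
Qed.

Section RayPolynomials.
Variables (K : fieldType) (H : monoidN2) (a : Z2).
Hypotheses (Ha : monoid_set H a) (a_neq0 : a <> 0).
Hypothesis a_split : forall u v n, monoid_set H u -> monoid_set H v ->
  u + v = a *+ n -> exists k, u = a *+ k.
Local Notation A := (semigroup_ring K H).

Lemma ray_mulrn_inj : injective (fun n => a *+ n).
Proof.
move=> i j /= e; wlog le : i j e / (i <= j)%N.
  by move=> th; case/orP: (leq_total i j) => /th -> //.
have /(Z2_mulrn_eq0 a_neq0) : a *+ (j - i) = 0 by rewrite mulrnBr // e subrr.
by move/eqP; rewrite subn_eq0 => ge; apply/eqP; rewrite eqn_leq le.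
Qed.

Lemma ray_mulrn_eq i j : (a *+ i == a *+ j :> Z2) = (i == j).
Proof. exact: (inj_eq ray_mulrn_inj). Qed.

Lemma monoid_mulrn h n : monoid_set H h -> monoid_set H (h *+ n).
Proof.
move=> Hh; elim: n => [|n IH]; first exact: (monoid_submonoid H).1.
by rewrite mulrS; apply: (monoid_submonoid H).2.
Qed.

(** The part of f on the ray, with x^a as the variable. The total degree of x^(n a) is at least n,
    so [msize] is a sufficient bound. *)
Definition ray_poly (f : A) : {poly K} :=
  \poly_(n < msize (to_mpoly f)) scoef f (a *+ n).

Lemma coef_ray_poly f n : (ray_poly f)`_n = scoef f (a *+ n).
Proof.
rewrite coef_poly; case: ltnP => // le; apply/esym/eqP; apply: contraTT le.
move=> /eqP/zcoef_neq0[k kf e]; rewrite -ltnNge; apply: leq_trans (msize_mdeg_lt kf).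
have [p0 q0] := monoid_nneg Ha.
move: e; rewrite Z2_mulrnE /mexp mdegE !big_ord_recl big_ord0 addn0 => -[e1 e2].
have -> : lift ord0 ord0 = ord_max :> 'I_2 by apply: val_inj.
rewrite ltnS; have a12 : 1 <= a.1 + a.2.
  rewrite leNgt; apply/negP => lt; apply: a_neq0.
  by apply: injective_projections => /=; lia.
by nia.
Qed.

Lemma ray_polyD f g : ray_poly (f + g) = ray_poly f + ray_poly g.
Proof. by apply/polyP => n; rewrite coefD !coef_ray_poly scoefD. Qed.

Lemma ray_polyB f g : ray_poly (f - g) = ray_poly f - ray_poly g.
Proof. by apply/polyP => n; rewrite coefB !coef_ray_poly scoefB. Qed.

Lemma ray_poly0 : ray_poly 0 = 0.
Proof. by apply/polyP => n; rewrite coef0 coef_ray_poly scoef0. Qed.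

(** The ray is a face: if u + v is a multiple of a, so are u and v, and no off-ray term
    contributes. *)
Lemma ray_polyM f g : ray_poly (f * g) = ray_poly f * ray_poly g.
Proof.
apply/polyP => n; rewrite coefM coef_ray_poly.
rewrite (@scoefM _ _ f g _ [seq a *+ i | i <- iota 0 n.+1]).
- rewrite big_map -{1}[iota 0 _]/(index_iota 0 n.+1) big_mkord.
  apply: eq_bigr => i _; rewrite !coef_ray_poly mulrnBr //.
  by rewrite -ltnS.
- by rewrite map_inj_uniq ?iota_uniq //; apply: ray_mulrn_inj.
move=> u fg; have Hu : monoid_set H u.
  by apply: (@scoef_neq0 _ _ f) => f0; apply: fg; rewrite f0 mul0r.
have Hv : monoid_set H (a *+ n - u).
  by apply: (@scoef_neq0 _ _ g) => f0; apply: fg; rewrite f0 mulr0.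
have [k ek] : exists k, u = a *+ k by apply: (a_split (n := n) Hu Hv); rewrite addrC subrK.
(* The multiple k is at most n, since otherwise a nonzero element and its opposite would both lie in
   H. *)
apply/mapP; exists k => //; rewrite mem_iota /= add0n ltnNge; apply/negP => lt.
have e : a *+ (k - n) = - (a *+ n - u) by rewrite opprB ek mulrnBr // ltnW.
have := @monoid_opp_eq0 H (a *+ (k - n)) (monoid_mulrn _ Ha).
rewrite {1}e opprK => /(_ Hv)/(Z2_mulrn_eq0 a_neq0)/eqP.
by rewrite subn_eq0 leqNgt lt.
Qed.

Definition ray_lift (p : {poly K}) : A := \sum_(i < size p) smon H p`_i (a *+ i).

Lemma ray_liftK p : ray_poly (ray_lift p) = p.
Proof.
apply/polyP => n; rewrite coef_ray_poly.
rewrite (big_morph (fun f => scoef f (a *+ n)) (fun f g => scoefD f g _) (scoef0 _ _ _)).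
under eq_bigr do rewrite (scoef_smon _ _ (monoid_mulrn _ Ha)) ray_mulrn_eq.
have [lt|ge] := ltnP n (size p); last first.
  rewrite nth_default // big1 // => i _; rewrite gtn_eqF ?mulr0 //.
  exact: leq_trans (ltn_ord i) ge.
rewrite (bigD1 (Ordinal lt)) //= eqxx mulr1 big1 ?addr0 // => i.
by rewrite -val_eqE /= eq_sym => /negPf ->; rewrite mulr0.
Qed.

Lemma smon_const (c : K) h : monoid_set H h -> smon H c h = smon H c 0 * smon H 1 h.
Proof.
by move=> Hh; rewrite smonM ?mulr1 ?add0r //; apply: (monoid_submonoid H).1.
Qed.

Lemma scoef_decomp (f : A) : exists2 L, uniq L &
  (forall u, u \in L -> scoef f u <> 0) /\ f = \sum_(u <- L) smon H (scoef f u) u.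
Proof.
have [L uL cL] := scoef_fin f.
exists [seq u <- L | scoef f u != 0]; first exact: filter_uniq.
split=> [u|]; first by rewrite mem_filter => /andP[/eqP].
apply: scoef_inj => v.
rewrite (big_morph (fun f => scoef f v) (fun f g => scoefD f g _) (scoef0 _ _ _)).
rewrite big_filter; under eq_bigr => u fu.
  rewrite scoef_smon; last by apply: (@scoef_neq0 _ _ f); apply/eqP.
  over.
have [v0|/eqP vn0] := eqVneq (scoef f v) 0.
  rewrite v0 big1 // => u fu; case: (v =P u) => [e|]; last by rewrite mulr0.
  by move: fu; rewrite -e v0 eqxx.
have vL := cL _ vn0; rewrite big_mkcond (bigD1_seq v) //= eqxx mulr1.
rewrite big1 => [|u uv]; last by rewrite (eq_sym v u) (negPf uv) mulr0 if_same.
by rewrite addr0; case: eqP.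
Qed.

(** The off-ray monomials span the kernel of [ray_poly]. *)
Definition contains_offray (P : set A) :=
  forall u, monoid_set H u -> (forall k, u <> a *+ k) -> P (smon H 1 u).

Lemma offray_kernel (P : set A) : @is_submodule A A^o P ->
  contains_offray P -> forall f, ray_poly f = 0 -> P f.
Proof.
move=> sP off f f0; have [L uL [Lf ->]] := scoef_decomp f.
rewrite big_seq; apply: (@submodule_sum A A^o) => // u uL'.
have fu := Lf u uL'; have Hu := scoef_neq0 fu.
rewrite smon_const //; apply: (@submodule_scale A A^o) => //.
apply: off => // k e; apply: fu; rewrite e -coef_ray_poly f0 coef0 //.
Qed.

(* Modulo P0 the ring is a quotient of K[x^a], where nonzero primes are maximal. *)
Lemma offray_prime_chain (P0 P1 P2 : set A) : is_prime_ideal P0 ->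
  is_prime_ideal P1 -> is_prime_ideal P2 -> contains_offray P0 ->
  P0 `<` P1 -> P1 `<` P2 -> False.
Proof.
move=> [sP0 _ _] [sP1 _ pr1] [sP2 n1 _] off [P01 /existsNP[f0 /not_implyP[f1 f0']]].
move=> [P12 /existsNP[h /not_implyP[h2 h1]]].
have ker0 := offray_kernel sP0 off.
have transfer f g : ray_poly f = ray_poly g -> P1 f -> P1 g.
  move=> e Pf; rewrite -[g](subrK f); apply: (@submodule_add A A^o) => //.
  by apply/P01/ker0; rewrite ray_polyB e subrr.
have smul P f g : @is_submodule A A^o P -> P g -> P (f * g).
  exact: (@submodule_scale A A^o).
(* Take f in P1 with nonzero image of least degree, and g the gcd of the images of f and h. If g is
   constant, Bezout puts 1 in P2. Otherwise a lift of g or of the cofactor r lies in P1: r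
   contradicts minimality, and g puts h in P1. *)
pose Q n := `[< exists f, [/\ P1 f, ray_poly f != 0 & size (ray_poly f) = n] >].
have Qex : exists n, Q n.
  exists (size (ray_poly f0)); apply/asboolP; exists f0; split=> //.
  by apply/eqP => /ker0.
have [n /asboolP[f [Pf fn0 sf]] nmin] := ex_minnP Qex.
have [[u v] /= guv] := Bezoutp (ray_poly f) (ray_poly h).
set g := gcdp _ _ in guv.
have gf : g %| ray_poly f := dvdp_gcdl _ _.
have gh : g %| ray_poly h := dvdp_gcdr _ _.
have gn0 : g != 0 by rewrite gcdp_eq0 negb_and fn0.
have [r er] := dvdpP _ _ gf; have [s es] := dvdpP _ _ gh.
have [g1|g1] := eqVneq (size g) 1%N.
- have : size (u * ray_poly f + v * ray_poly h) == 1%N by rewrite (eqp_size guv) g1.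
  move=> /size_poly1P[c c0 ec]; apply: n1.
  pose w := ray_lift u * f + ray_lift v * h.
  have Pw : P2 w.
    by apply: (@submodule_add A A^o) => //; apply: smul => //; apply: P12.
  have ew : ray_poly (ray_lift c^-1%:P * w) = 1.
    rewrite ray_polyM ray_liftK ray_polyD !ray_polyM !ray_liftK ec -polyCM mulVf //.
  rewrite -[1](subrK (ray_lift c^-1%:P * w)); apply: (@submodule_add A A^o) => //.
    apply/P12/P01/ker0; rewrite ray_polyB ew; apply/polyP => k.
    rewrite coefB coef_ray_poly coef1 coef0 -smon1 scoef_smon; last first.
      exact: (monoid_submonoid H).1.
    by rewrite mul1r -[X in _ == X](mulr0n a) ray_mulrn_eq subrr.
  exact: smul.
have : P1 (ray_lift r * ray_lift g).
  by apply: transfer Pf; rewrite ray_polyM !ray_liftK.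
case/pr1 => [Pr|Pg].
- have rn0 : r != 0 by apply: contraNneq fn0 => r0; rewrite er r0 mul0r.
  have : (n <= size r)%N.
    by apply: nmin; apply/asboolP; exists (ray_lift r); rewrite ray_liftK.
  rewrite -sf er size_mul // leqNgt; case: (size g) (size_poly_eq0 g) g1 => [|[|k]] //=.
    by rewrite (negPf gn0).
  by move=> _ _; rewrite !addnS /= ltnS leq_addr.
apply: h1; apply: transfer (smul _ (ray_lift s) _ sP1 Pg).
by rewrite ray_polyM !ray_liftK.
Qed.

End RayPolynomials.

(** * Krull dimension *)

Section KrullDimension.
Variables (K : fieldType) (H : monoidN2) (b a1 a2 : Z2).
Variables (J : finType) (pt : J -> nat -> Z2) (dir : J -> Z2) (lev : J -> nat).
Hypothesis SD : strip_decomposition H b a1 a2 pt dir lev.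
Local Notation A := (semigroup_ring K H).
Local Notation S := (cell H b a1 a2).
Variables (V : lmodType A) (vc : V -> Z2 -> K) (vm : Z2 -> V).
Hypothesis VB : monomial_module S vc vm.
Local Notation m := (@graded_maximal_ideal K H).

Lemma smonX h n : monoid_set H h -> smon H (1 : K) h ^+ n = smon H 1 (h *+ n).
Proof.
move=> Hh; elim: n => [|n IH]; first by rewrite smon1.
by rewrite exprS IH smonM ?mulr1 -?mulrS //; apply: monoid_mulrn.
Qed.

Lemma prime_ideal_exp (P : set A) x n : is_prime_ideal P -> P (x ^+ n) -> P x.
Proof.
move=> [_ n1 pr]; elim: n => [/n1 //|n IH].
by rewrite exprS => /pr[].
Qed.

Lemma smon_ann g : monoid_set H g -> monoid_set H (g - b) ->
  @ann A V (smon H 1 g).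
Proof.
move=> Hg Hgb v; apply: (vc_eq0 VB) => h.
have [Sh|nSh] := pselect (S h); last exact: (vc_out VB).
rewrite (vc_smon VB) // mul1r; apply: (vc_out VB) => Sg; have [_ _] := Sh; apply.
have -> : h - b = (h - g) + (g - b) by rewrite addrA subrK.
by apply: (monoid_submonoid H).2 => //; apply: (cell_monoid SD).
Qed.

(** If x^u and x^v escape P, with u off the first ray and v off the second, then so do all powers of
    x^(u + v); but one of these lies in b + H and kills V. *)
Lemma prime_contains_offray (P : set A) : is_prime_ideal P -> @ann A V `<=` P ->
  contains_offray a1 P \/ contains_offray a2 P.
Proof.
move=> prP annP; have [|n1] := pselect (contains_offray a1 P); first by left.
right=> v Hv va2; apply: contrapT => nPv; apply: n1 => u Hu ua1.
have Huv := (monoid_submonoid H).2 _ _ Hu Hv.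
have [n Hn] := interior_multiple SD Hu Hv ua1 va2.
have : P ((smon H 1 u * smon H 1 v) ^+ n).
  by rewrite smonM // mulr1 smonX //; apply/annP/smon_ann => //; apply: monoid_mulrn.
move=> /(prime_ideal_exp prP); have [_ _ pr] := prP.
by case/pr.
Qed.

Lemma krull_dim1 (j : J) : krull_dim V 1.
Proof.
have [[Ha1 Ha2] [a10 a20]] := (ray_monoid SD, ray_neq0 SD).
have rays a : a = a1 \/ a = a2 -> monoid_set H a /\ a <> 0 by case=> ->.
have split1 a : a = a1 \/ a = a2 -> forall u v n, monoid_set H u ->
    monoid_set H v -> u + v = a *+ n -> exists k, u = a *+ k.
  by move=> ea u v n; apply: (extremal_split SD ea).
split; last first.
  move=> c n [cP cinc]; rewrite leqNgt; apply/negP => n2.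
  have [p0 an0] := cP 0%N isT; have [p1 _] := cP 1%N (ltnW n2); have [p2 _] := cP 2%N n2.
  by case: (prime_contains_offray p0 an0) => off;
    [have [Ha a0] := rays a1 (or_introl erefl); have sp := split1 a1 (or_introl erefl)
    |have [Ha a0] := rays a2 (or_intror erefl); have sp := split1 a2 (or_intror erefl)];
    case: (offray_prime_chain Ha a0 sp p0 p1 p2 off
      (cinc 0%N (ltnW n2)) (cinc 1%N n2)).
have [Ha a0] := rays _ (dirE SD j); have sp := split1 _ (dirE SD j).
pose phi := @ray_poly K H (dir j).
have phi_coef f n : (phi f)`_n = scoef f (dir j *+ n) by apply: coef_ray_poly.
have scoef1 : scoef (1 : A) 0 = 1.
  by rewrite -smon1 scoef_smon ?eqxx ?mulr1 //; apply: (monoid_submonoid H).1.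
(* The coordinate of f x^([pt j 0]) at [pt j n] is the coefficient of f at n times [dir j]. *)
have ann_phi : @ann A V `<=` [set f | phi f = 0].
  move=> f fV; apply/polyP => n; rewrite phi_coef coef0.
  rewrite -(vc0 VB (pt j n)) -(fV (vm (pt j 0%N))).
  rewrite (@vcZ _ _ _ _ _ _ VB _ _ _ [:: dir j *+ n]) //.
  - rewrite big_seq1 (ptE SD j n) addrK (vc_vm VB) ?eqxx ?mulr1 //.
    exact: cell_pt_in SD _ _.
  - exact: cell_pt_in SD _ _.
  move=> u fu; rewrite inE; apply/eqP.
  rewrite (vc_vm VB) in fu; last exact: cell_pt_in SD _ _.
  move: fu; case: eqP => [e _|]; last by rewrite mulr0.
  apply: (addrI (pt j 0%N)); rewrite -(ptE SD) -e subrK //.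
(* The kernels of the maps to K[t] and to K; [x^(dir j)] separates them. *)
exists (fun i => if i == 0%N then [set f | phi f = 0] else [set f | scoef f 0 = 0]).
have sub01 : [set f | phi f = 0] `<=` [set f : A | scoef f 0 = 0].
  by move=> f /= f0; rewrite -[0](mulr0n (dir j)) -phi_coef f0 coef0.
split=> [[|i] _ /=|[|i] //= _].
- split=> //; split.
  + split=> [|f u v /= u0 v0] /=; first exact: ray_poly0.
    by rewrite /phi ray_polyD // -[f *: u]/(f * (u : A)) ray_polyM // -/phi u0 v0 mulr0 addr0.
  + move=> /= e; have := phi_coef 1 0%N; rewrite e coef0 mulr0n scoef1.
    by move/esym/eqP; rewrite oner_eq0.
  + move=> f g /= /eqP; rewrite /phi ray_polyM // mulf_eq0.
    by case/orP => /eqP; [left | right].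
- split; last exact: subset_trans sub01.
  split.
  + split=> [|f u v /= u0 v0] /=; first exact: scoef0.
    by rewrite scoefD -[f *: u]/(f * (u : A)) scoefM0 u0 v0 mulr0 addr0.
  + by move=> /= /eqP; rewrite scoef1 oner_eq0.
  + move=> f g /= /eqP; rewrite scoefM0 mulf_eq0.
    by case/orP => /eqP; [left | right].
- split=> // /(_ (smon H 1 (dir j))) /=; rewrite scoef_smon //.
  case: eqP => [/esym//|_]; rewrite mulr0 => /(_ erefl) e.
  have := phi_coef (smon H 1 (dir j)) 1%N; rewrite e coef0 mulr1n scoef_smon //.
  by rewrite eqxx mulr1 => /esym/eqP; rewrite oner_eq0.
Qed.

(** Without strips V is zero, which counts as Ulrich, and indecomposability is vacuous. Otherwise
    the multiplicity is #|J|. *)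
Lemma ulrich_moduleP : ulrich_module V m <-> indecomposable H pt.
Proof.
have [[j0]|nJ] := pselect (inhabited J); last first.
  split=> _; first by move=> j; case: nJ.
  by left=> v; apply: (vc_ptE SD VB) => j; case: nJ.
have kd := krull_dim1 j0.
split=> [[z0|[_ [n [gn /(multiplicityE SD VB _ kd)/eqP]]]]|ind].
- by case: (vm_neq0 VB (cell_pt_in SD j0 0)); apply: z0.
- by rewrite eqr_nat => /eqP en; apply/(min_number_gensP SD VB); rewrite -en.
- right; split; first by exists 1%N; split=> //; apply: (depth1 SD VB j0).
  exists #|J|; split; first exact/(min_number_gensP SD VB).
  exact/(multiplicityE SD VB _ kd).
Qed.

End KrullDimension.

(** * The quotient omega_R / x^b R *)

Local Open Scope quotient_scope.

Section OmegaQuotient.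
Variables (K : fieldType) (H : monoidN2) (R : realType) (b a1 a2 : Z2).
Hypothesis Hb : monoid_set H b.
Hypothesis omega_cdet :
  forall v, omega R H v <-> 0 < cdet a1 v /\ 0 < cdet v a2.
Local Notation A := (semigroup_ring K H).
Local Notation S := (cell H b a1 a2).
Local Notation E := (omega_quotient K H R b).
Local Notation N := (@xpow_multiples K H R b).

Definition omega_coef (w : canonical_module K H R) : Z2 -> K :=
  scoef (omega_incl w).

(** Elements of x^b R have support in b + H, so on cells the coefficient does not depend on the
    representative; elsewhere it is masked to 0. *)
Definition quot_coef (z : E) (v : Z2) : K :=
  if `[< S v >] then omega_coef (repr z) v else 0.

Definition quot_mon (v : Z2) : E :=
  \pi_(quotmod N) (insubd (0 : canonical_module K H R) (smon H 1 v : A^o)).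

Lemma omega_coefD u w v : omega_coef (u + w) v = omega_coef u v + omega_coef w v.
Proof. by rewrite /omega_coef /omega_incl submod_valD scoefD. Qed.

Lemma omega_coefZ f w : omega_coef (f *: w) = scoef (f * omega_incl w).
Proof. by rewrite /omega_coef /omega_incl submod_valZ. Qed.

Lemma omega_coefB u w v : omega_coef (u - w) v = omega_coef u v - omega_coef w v.
Proof. by apply/eqP; rewrite eq_sym subr_eq -omega_coefD subrK. Qed.

Lemma omega_coef_neq0 w v : omega_coef w v <> 0 -> omega R H v.
Proof.
move: v; have : submod_val w \in @omega_pred K H R by exact: (valP w).
by rewrite unfold_in => /zcoef_span.
Qed.

Lemma xpow_multiplesP w : w \in N <->
  forall v, omega_coef w v <> 0 -> monoid_set H (v - b).
Proof.
have [b1 b2] := monoid_nneg Hb.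
split=> [/asboolP[r wr] v|wN].
  rewrite /omega_coef /scoef wr xpowE zcoefXM expmK // => nz.
  exact: (@scoef_neq0 _ _ r).
apply/asboolP; have [L uL [Lw ew]] := scoef_decomp (omega_incl w).
exists (\sum_(v <- L) smon H (scoef (omega_incl w) v) (v - b)).
have -> : xpow K b = to_mpoly (smon H 1 b) by rewrite smon_mpoly // scale1r xpowE.
rewrite -to_mpolyM mulr_sumr; congr to_mpoly; rewrite [LHS]ew.
rewrite big_seq [RHS]big_seq; apply: eq_bigr => v vL.
by rewrite smonM ?mul1r; [rewrite addrC subrK|by []|apply: wN; apply: Lw].
Qed.

Lemma quot_coef_pi w v : S v -> quot_coef (\pi_(quotmod N) w) v = omega_coef w v.
Proof.
move=> Sv; rewrite /quot_coef (asboolT Sv).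
have /quotmod_eq : \pi_(quotmod N) (repr (\pi_(quotmod N) w)) = \pi_(quotmod N) w.
  by rewrite reprK.
move=> /xpow_multiplesP/(_ v); rewrite omega_coefB => nz.
apply/eqP; rewrite -subr_eq0; apply/eqP; apply: contrapT => /nz Hvb.
by case: Sv.
Qed.

Lemma quot_coef_out z v : ~ S v -> quot_coef z v = 0.
Proof. by rewrite /quot_coef; case: asboolP. Qed.

(** The mask is harmless in products: if h - u is not a cell, it lies outside omega_H, since
    otherwise h - u, and with it h, would lie in b + H. *)
Lemma quot_coef_trans (f : A) w h u : S h -> scoef f u <> 0 ->
  quot_coef (\pi_(quotmod N) w) (h - u) = omega_coef w (h - u).
Proof.
move=> Sh fu; have [Su|nSu] := pselect (S (h - u)); first exact: quot_coef_pi.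
rewrite quot_coef_out //; apply/esym; apply: contrapT => /omega_coef_neq0/omega_cdet[w1 w2].
apply: nSu; split=> // Hub; case: Sh => _ _; apply.
have -> : h - b = u + (h - u - b) by rewrite addrA addrCA subrr addr0.
by apply: (monoid_submonoid H).2 => //; apply: scoef_neq0 fu.
Qed.

Lemma omega_coef_mon h g : monoid_set H h -> S h ->
  omega_coef (insubd (0 : canonical_module K H R) (smon H 1 h : A^o)) g = (g == h)%:R.
Proof.
move=> Hh [h1 h2 _]; rewrite /omega_coef /omega_incl /submod_val insubdK.
  by rewrite scoef_smon // mul1r.
rewrite unfold_in /=; apply/zcoef_span => v; rewrite -/(scoef _ v) scoef_smon //.
by rewrite mul1r; case: eqP => // -> _; apply/omega_cdet.
Qed.

Lemma omega_quotient_basis : (forall v, S v -> monoid_set H v) ->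
  monomial_module S quot_coef quot_mon.
Proof.
move=> SH; split.
- move=> z1 z2 h; have [Sh|nSh] := pselect (S h); last by rewrite !quot_coef_out ?addr0.
  have [w1 ->] := quotmodP z1; have [w2 ->] := quotmodP z2.
  by rewrite quotmod_addE !quot_coef_pi // omega_coefD.
- by move=> z h; apply: quot_coef_out.
- move=> z; have [w ->] := quotmodP z; have [L uL cL] := scoef_fin (omega_incl w).
  exists L => // h; have [Sh|nSh] := pselect (S h); last by rewrite quot_coef_out.
  by rewrite quot_coef_pi //; apply: cL.
- move=> z; have [w ->] := quotmodP z => w0.
  (* Zero is written as the class of some [v]; the classes of v + v and v then agree, which puts v
     in the submodule. *)
  have [v ev] := quotmodP (0 : quotmod N); rewrite ev.
  have vN : v \in N.
    rewrite -[v](addrK v); apply/quotmod_eq.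
    by rewrite -quotmod_addE -ev addr0.
  apply/quotmod_eq; rewrite rpredB //; apply/xpow_multiplesP => h hw.
  apply: contrapT => nH; apply: hw; have [Sh|nSh] := pselect (S h).
    by rewrite -quot_coef_pi.
  apply: contrapT => /omega_coef_neq0/omega_cdet[h1 h2]; apply: nSh.
  by split.
- move=> h g Sh; have [Sg|nSg] := pselect (S g).
    by rewrite quot_coef_pi // omega_coef_mon //; apply: SH.
  by rewrite quot_coef_out //; case: eqP => // e; case: nSg; rewrite e.
- move=> f z h L Sh uL; have [w ->] := quotmodP z => cL.
  have -> : f *: (\pi_(quotmod N) w : E) = \pi_(quotmod N) (f *: w).
    exact: quotmod_scale_pi.
  rewrite quot_coef_pi // omega_coefZ (@scoefM _ _ _ _ _ L) // => [|u fw].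
    apply: eq_bigr => u _; have [->|/eqP fu] := eqVneq (scoef f u) 0.
      by rewrite !mul0r.
    by rewrite (quot_coef_trans _ Sh fu).
  apply: cL; have [f0|/eqP fu] := eqVneq (scoef f u) 0.
    by case: fw; rewrite f0 mul0r.
  by rewrite (quot_coef_trans _ Sh fu).
Qed.

End OmegaQuotient.

(** * The bottom element, the AG conditions and the equivalences *)

Section BottomElement.
Variables (R : realType) (H : monoidN2) (a1 a2 : Z2).
Hypothesis omega_cdet :
  forall v, omega R H v <-> 0 < cdet a1 v /\ 0 < cdet v a2.
Hypothesis HP : forall v, monoid_set H v <-> 0 <= cdet a1 v /\ 0 <= cdet v a2.

(** Positive determinants force both coordinates of a point of omega_H to be at least 1. Uniqueness
    serves to instantiate the existential in [AG]. *)
Lemma bottom11 : 0 < a1.1 -> 0 < a2.2 -> 0 <= a1.2 -> 0 <= a2.1 ->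
  omega R H (1, 1) -> forall b, is_bottom R H b <-> b = (1, 1).
Proof.
move=> p1 p2 q1 q2 o11; have bot : is_bottom R H (1, 1).
  split=> // v /omega_cdet[v1 v2].
  have [r s] : 0 <= v.1 /\ 0 <= v.2.
    by apply: monoid_nneg; apply/HP; split; apply: ltW.
  by move: v1 v2; rewrite /cdet /= => v1 v2; split; nia.
move=> b; split=> [[ob bmin]|->//].
have [h1 h2] := bmin _ o11; have [g1 g2] := bot.2 _ ob.
by move: b ob bmin h1 h2 g1 g2 => [p q] /= *; congr (_, _); lia.
Qed.

End BottomElement.

Lemma Hstar11P (R : realType) (x y : int) (v : Z2) : y < x ->
  Hstar R (x, y) (1, 1) v <->
    0 < v.1 - v.2 < x - y /\ 0 < cdet (x, y) v < x - y.
Proof.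
move=> yx; have dz : 0 < x - y by lia.
have d0 : 0 < (x - y)%:~R :> R by rewrite ltr0z.
have dn0 := lt0r_neq0 d0.
split=> [[r [s [/andP[r0 r1] /andP[s0 s1] [e1 e2]]]]|[/andP[k0 k1] /andP[c0 c1]]].
- have {}e1 : v.1%:~R = r * x%:~R + s by rewrite e1 -[LHS]/(_ * _ + _ * _) mulr1.
  have {}e2 : v.2%:~R = r * y%:~R + s by rewrite e2 -[LHS]/(_ * _ + _ * _) mulr1.
  have f1 : (v.1 - v.2)%:~R = r * (x - y)%:~R :> R.
    by rewrite !intrB e1 e2; ring.
  have f2 : (cdet (x, y) v)%:~R = s * (x - y)%:~R :> R.
    by rewrite /cdet !intrB !intrM e1 e2; ring.
  rewrite -!(ltr0z R) -!(ltr_int R) f1 f2 !pmulr_lgt0 // r0 s0 /=.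
  by rewrite !gtr_pMl // r1 s1.
- exists ((v.1 - v.2)%:~R / (x - y)%:~R), ((cdet (x, y) v)%:~R / (x - y)%:~R).
  split; rewrite ?divr_gt0 ?ltr0z ?ltr_pdivrMr ?mul1r ?ltr_int //=.
  apply: injective_projections; rewrite /= -[RHS]/(_ * _ + _ * _);
    move: dn0; rewrite /cdet !intrB !intrM /= => dn0; by field.
Qed.

Lemma Hstar_swap (R : realType) (a v : Z2) :
  Hstar R (swap a) (1, 1) (swap v) <-> Hstar R a (1, 1) v.
Proof.
suff imp (c w : Z2) : Hstar R c (1, 1) w -> Hstar R (swap c) (1, 1) (swap w).
  by split=> [/imp|/imp]; rewrite ?swapK.
move=> [r [s [r01 s01 [e1 e2]]]]; exists r, s; split=> //.
exact: injective_projections.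
Qed.

Lemma AG11P (R : realType) (H : monoidN2) (x y : int) : y < x ->
  (forall b, is_bottom R H b <-> b = (1, 1)) ->
  AG R H (x, y) <-> strip_sumfree x y.
Proof.
move=> yx bot; split=> [[b [/bot -> sf]] p q p1 p2 q1 q2 pq|sf].
  by apply: (sf p q); apply/Hstar11P.
exists (1, 1); split; first exact/bot.
move=> p q /(Hstar11P _ _ yx)[p1 p2] /(Hstar11P _ _ yx)[q1 q2] /(Hstar11P _ _ yx).
exact: sf.
Qed.

Lemma AG11_swapP (R : realType) (H : monoidN2) (x y : int) : x < y ->
  (forall b, is_bottom R H b <-> b = (1, 1)) ->
  AG R H (x, y) <-> strip_sumfree y x.
Proof.
move=> xy bot.
have sw v : Hstar R (x, y) (1, 1) v <->
   0 < (swap v).1 - (swap v).2 < y - x /\ 0 < cdet (y, x) (swap v) < y - x.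
  by rewrite -Hstar_swap; apply: Hstar11P.
split=> [[b [/bot -> sf]] p q p1 p2 q1 q2 pq|sf].
  by apply: (sf (swap p) (swap q)); apply/sw; rewrite -?swapD swapK.
exists (1, 1); split; first exact/bot.
move=> p q /sw[p1 p2] /sw[q1 q2] /sw; rewrite swapD.
exact: sf.
Qed.

Theorem theorem6p3 (R : realType) (K : fieldType) (H : monoidN2)
    (x1 y1 x2 y2 : int)
    (H_N2 : in_N2_class R H)
    (H_rays : labeled_extremal_rays R H (x1, y1) (x2, y2))
    (H_bottom : omega R H (1, 1)) :
  [/\ AG R H (x1, y1) <-> (x1 = 1 %[mod x1 - y1])%Z,
      AG R H (x2, y2) <-> (y2 = 1 %[mod y2 - x2])%Z &
      ulrich_element K H R (1, 1) <->
        (x1 = 1 %[mod x1 - y1])%Z /\ (x2 = 1 %[mod x2 - y2])%Z].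
Proof.
have [[Ha1 /= co1 _] [Ha2 /= co2 _] /= x1_gt0 _] := H_rays.
have [/= _ y1_ge0] := monoid_nneg Ha1; have [/= x2_ge0 _] := monoid_nneg Ha2.
have HP := monoidP H_N2 H_rays; have HO := omegaP H_N2 H_rays.
have /HO[yx1 xy2] := H_bottom.
have {}yx1 : y1 < x1 by move: yx1; rewrite /cdet /=; lia.
have {}xy2 : x2 < y2 by move: xy2; rewrite /cdet /=; lia.
have co2' : coprimez y2 x2 by rewrite /coprimez gcdzC.
have bot : forall b, is_bottom R H b <-> b = (1, 1).
  by apply: (@bottom11 R H (x1, y1) (x2, y2)) => //=; lia.
have sf1 := strip_sumfreeP y1_ge0 yx1 co1.
have sf2 := strip_sumfreeP x2_ge0 xy2 co2'.
(* The two moduli are opposite, and x2 differs from y2 by the modulus. *)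
have mod2 : (y2 = 1 %[mod y2 - x2])%Z <-> (x2 = 1 %[mod x2 - y2])%Z.
  have modE (u d : int) : (u = 1 %[mod d])%Z <-> (d %| u - 1)%Z.
    by rewrite -eqz_mod_dvd; split=> /eqP.
  rewrite !modE; split=> /dvdzP[q e]; apply/dvdzP.
    exists (1 - q); have -> : x2 - 1 = (y2 - 1) - (y2 - x2) by ring.
    by rewrite e; ring.
  exists (1 - q); have -> : y2 - 1 = (x2 - 1) - (x2 - y2) by ring.
  by rewrite e; ring.
split; first by rewrite (AG11P yx1 bot).
  by rewrite (AG11_swapP xy2 bot).
rewrite -mod2 -sf1 -sf2 -(indecomposableP y1_ge0 x2_ge0 yx1 xy2 co1 co2' HP).
have SD := cell_strips y1_ge0 x2_ge0 yx1 xy2 co1 co2' HP.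
have Hb : monoid_set H (1, 1).
  by apply/HP; have /HO[b1 b2] := H_bottom; split; apply: ltW.
have VB := @omega_quotient_basis K H R (1, 1) (x1, y1) (x2, y2) Hb HO (cell_monoid SD).
rewrite -[X in _ <-> X](ulrich_moduleP SD VB).
by split=> [[]|].
Qed.
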